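(* Let $a \in (0,1)$ and let $R_a = [-1,1]\times[-a,a]$ (every rectangle that is not a square is similar to exactly one such $R_a$). Let $\nu$ be the smallest positive solution of $\tan(\nu) = \coth(\nu a)$. Then the first Steklov eigenspace of $R_a$, i.e. the eigenspace for the smallest nonzero Steklov eigenvalue $\sigma_1(R_a)$, has basis $\{\sin(\nu x)\cosh(\nu y)\}$.
   Context: For a bounded planar Lipschitz domain $\Omega$, a Steklov eigenvalue is a real number $\sigma$ for which there is a nonzero function $s$ (a Steklov eigenfunction) with $\Delta s = 0$ in $\Omega$ and $\partial_n s = \sigma s$ on $\partial\Omega$, where $\partial_n$ is the outward normal derivative (for a rectangle: the conditions hold on the open sides, or equivalently in the weak $H^1$ sense). The eigenvalues form a discrete sequence $0=\sigma_0<\sigma_1\le\sigma_2\le\cdots$, and $\sigma_1(\Omega)$ denotes the smallest nonzero (nontrivial) eigenvalue. Rectangles are normalized up to similarity to the form $[-1,1]\times[-a,a]$ with $0<a\le 1$. *)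

(* Defs.v *)
From Stdlib Require Export Reals List.
From Coquelicot Require Export Coquelicot.
Export ListNotations.
Open Scope R_scope.

Definition is_least (P : R -> Prop) (x : R) : Prop :=
  P x /\ forall y, P y -> x <= y.

Definition coth (x : R) : R := cosh x / sinh x.

Definition rect (a : R) (p : R * R) : Prop :=
  -1 <= fst p <= 1 /\ - a <= snd p <= a.

Definition open_rect (a : R) (p : R * R) : Prop :=
  -1 < fst p < 1 /\ - a < snd p < a.

Definition laplacian (u : R -> R -> R) (x y : R) : R :=
  partial_derive 2 0 u x y + partial_derive 0 2 u x y.

(* [n . grad u] tends to [l] at the point [p] from inside the open rectangle.
   For [p] on an open side and [n] the outward unit normal there, this says
   that the normal derivative extends continuously to [p] with value [l]. *)
Definition is_normal_derivative (a : R) (u : R -> R -> R)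
    (p n : R * R) (l : R) : Prop :=
  filterlim
    (fun q : R * R => fst n * partial_derive 1 0 u (fst q) (snd q)
                      + snd n * partial_derive 0 1 u (fst q) (snd q))
    (within (open_rect a) (locally p)) (locally l).

(* The corners carry no normal derivative; continuity on the closed rectangle
   is what controls [s] there.  It plays the role of the H^1 condition: without
   it, harmonic functions blowing up at a corner would be admitted.  Only the
   values of [s] on the closed rectangle matter. *)
Definition steklov_eigenspace (a sigma : R) (s : R -> R -> R) : Prop :=
  continuous_on (rect a) (fun p : R * R => s (fst p) (snd p)) /\
  (forall x y, open_rect a (x, y) ->
     ex_diff_n s 2 x y /\ laplacian s x y = 0) /\
  (forall y, - a < y < a ->
     is_normal_derivative a s (1, y) (1, 0) (sigma * s 1 y) /\
     is_normal_derivative a s (-1, y) (-1, 0) (sigma * s (-1) y)) /\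
  (forall x, -1 < x < 1 ->
     is_normal_derivative a s (x, a) (0, 1) (sigma * s x a) /\
     is_normal_derivative a s (x, - a) (0, -1) (sigma * s x (- a))).

Definition steklov_eigenvalue (a sigma : R) : Prop :=
  exists s : R -> R -> R,
    steklov_eigenspace a sigma s /\
    exists x y, rect a (x, y) /\ s x y <> 0.

Definition is_first_steklov_eigenvalue (a sigma : R) : Prop :=
  is_least (fun t => t <> 0 /\ steklov_eigenvalue a t) sigma.

Fixpoint lin_comb (c : list R) (b : list (R -> R -> R)) (x y : R) : R :=
  match c, b with
  | k :: c', f :: b' => k * f x y + lin_comb c' b' x y
  | _, _ => 0
  end.

(* Functions are identified when they agree on the closed rectangle. *)
Definition is_basis (a : R) (E : (R -> R -> R) -> Prop)
    (b : list (R -> R -> R)) : Prop :=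
  List.Forall E b /\
  (forall c : list R, length c = length b ->
     (forall x y, rect a (x, y) -> lin_comb c b x y = 0) ->
     List.Forall (fun k => k = 0) c) /\
  (forall s, E s ->
     exists c : list R, length c = length b /\
       forall x y, rect a (x, y) -> s x y = lin_comb c b x y).

(* Main.v *)
(* Let [T_l] be the Green operator of [-d^2/dx^2] on [[-l, l]] with the Robin
   conditions [f'(l) = sigma f(l)], [f'(-l) = - sigma f(-l)].  If [s] is a Steklov
   function for [sigma] on [[-l, l] x [-m, m]], then [h = T_l s + T_m s] (one operator
   in each variable) vanishes: [h] has zero second differences in each variable, so
   it is bilinear, and its Robin difference quotients at a corner tend to zero because
   [s] is continuous there.  No bound on the gradient near the corners is needed.

   For [sigma < 1], [T_l] is positive on the functions orthogonal to its only negative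
   mode [cosh (p x)].  Hence [s = 0] as soon as [s] is orthogonal to the negative modes
   in [x] and in [y], since the nonnegative forms [<s, T_l s>] and [<s, T_m s>] add up
   to zero.  The components of [s] along these modes solve [d'' = - r^2 d] with Robin
   conditions, and comparing frequencies shows that for [sigma <= sigma1] the only
   nonzero possibility is [sin (nu x) cosh (nu y)] at [sigma = sigma1]. *)

Require Import Defs.
From Stdlib Require Import Reals List Lra.
From Coquelicot Require Import Coquelicot.
Import ListNotations.
Open Scope R_scope.

(** Formally [h_xx = (T_l s)_xx + T_m s_xx = - s - T_m s_yy = 0], the last step because [s]
    satisfies the Robin conditions in [y], so that [T_m] undoes [- d^2/dy^2]. The obstacle is that
    [s_xx] is controlled only inside the rectangle, whereas [T_m] integrates up to the sides. A
    second difference in [x] avoids this: near the sides [y = m] and [y = - m] it uses only the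
    normal derivative, which has a limit there. The eigenvalue is
    [sigma1 = nu tanh (nu a) = nu cot nu], and [nu cos nu < sin nu] puts it below 1. Then, on both
    half-lengths 1 and [a], the denominators [1 - sigma l] of the Green kernels stay positive and no
    odd function gives a negative mode: [sinh (p x)] would need [p coth (p l) = sigma], but the left
    side exceeds [1 / l]. The condition [a < 1] separates the two negative modes. At [sigma1] the
    mode in [y] has frequency exactly [nu], while the mode in [x] has a frequency below [nu] and is
    not resonant. In a square they would coincide, and exchanging [x] and [y] would give a second
    eigenfunction. *)

(** * Continuity and integration of functions of one real variable *)

Lemma continuous_Rplus (f g : R -> R) (x : R) :
  continuous f x -> continuous g x -> continuous (fun t => f t + g t) x.
Proof. intros; now apply (continuous_plus f g). Qed.

Lemma continuous_Rminus (f g : R -> R) (x : R) :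
  continuous f x -> continuous g x -> continuous (fun t => f t - g t) x.
Proof. intros; now apply (continuous_minus f g). Qed.

Lemma continuous_Ropp (f : R -> R) (x : R) :
  continuous f x -> continuous (fun t => - f t) x.
Proof. intros; now apply (continuous_opp f). Qed.

Lemma continuous_Rmult (f g : R -> R) (x : R) :
  continuous f x -> continuous g x -> continuous (fun t => f t * g t) x.
Proof. intros; now apply (continuous_mult f g). Qed.

Lemma continuous_Rcomp (f g : R -> R) (x : R) :
  continuous g x -> (forall t, continuous f t) -> continuous (fun t => f (g t)) x.
Proof. intros; now apply (continuous_comp g f). Qed.

Lemma continuity_pt_ex_derive (f : R -> R) (x : R) : ex_derive f x -> continuity_pt f x.
Proof.
  intros; now apply continuity_pt_filterlim, (ex_derive_continuous (V := R_NormedModule)).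
Qed.

Lemma continuous_of_is_derive (f f' : R -> R) :
  (forall x, is_derive f x (f' x)) -> forall x, continuous f x.
Proof.
  intros H x; apply (ex_derive_continuous (V := R_NormedModule)).
  exists (f' x); apply H.
Qed.

Ltac cont :=
  lazymatch goal with
  | |- forall _, _ => intro; cont
  | |- continuous (fun _ => ?c) _ => apply continuous_const
  | |- continuous (fun t => t) _ => apply continuous_id
  | |- continuous (fun t => @?f t + @?g t) _ => apply (continuous_Rplus f g); cont
  | |- continuous (fun t => @?f t - @?g t) _ => apply (continuous_Rminus f g); cont
  | |- continuous (fun t => @?f t * @?g t) _ => apply (continuous_Rmult f g); cont
  | |- continuous (fun t => - @?f t) _ => apply (continuous_Ropp f); cont
  | |- continuous (fun t => ?f (@?g t)) _ =>
      first [ match goal with H : forall x, continuous f x |- _ =>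
                apply (continuous_Rcomp f g); [cont|exact H] end
            | (apply (ex_derive_continuous (V := R_NormedModule)); auto_derive; now auto)
            | auto ]
  | |- _ => auto
  end.
Lemma ex_RInt_cont (f : R -> R) (a b : R) :
  (forall x, continuous f x) -> ex_RInt f a b.
Proof. intros H; apply (ex_RInt_continuous (V := R_CompleteNormedModule)); auto. Qed.

Lemma RInt_Rplus (f g : R -> R) (a b : R) :
  (forall x, continuous f x) -> (forall x, continuous g x) ->
  RInt (fun t => f t + g t) a b = RInt f a b + RInt g a b.
Proof. intros; apply (RInt_plus f g); now apply ex_RInt_cont. Qed.

Lemma RInt_Rminus (f g : R -> R) (a b : R) :
  (forall x, continuous f x) -> (forall x, continuous g x) ->
  RInt (fun t => f t - g t) a b = RInt f a b - RInt g a b.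
Proof. intros; apply (RInt_minus f g); now apply ex_RInt_cont. Qed.

Lemma RInt_Rscal (f : R -> R) (k a b : R) :
  (forall x, continuous f x) -> RInt (fun t => k * f t) a b = k * RInt f a b.
Proof. intros; apply (RInt_scal f a b k); now apply ex_RInt_cont. Qed.

Lemma RInt_ftc (F f : R -> R) (a b : R) :
  (forall x, Rmin a b <= x <= Rmax a b -> is_derive F x (f x)) ->
  (forall x, Rmin a b <= x <= Rmax a b -> continuous f x) ->
  RInt f a b = F b - F a.
Proof.
  intros HF Hf; apply is_RInt_unique.
  now apply (is_RInt_derive (V := R_CompleteNormedModule) F f a b).
Qed.

Lemma is_derive_primitive (f : R -> R) (a x : R) :
  (forall t, continuous f t) -> is_derive (fun b => RInt f a b) x (f x).
Proof.
  intros Hf; apply (is_derive_RInt (V := R_NormedModule) f _ a x).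
  - apply filter_forall; intros b.
    now apply (RInt_correct (V := R_CompleteNormedModule)), ex_RInt_cont.
  - apply Hf.
Qed.

Lemma RInt_zero_fun (f : R -> R) (a b : R) :
  a <= b -> (forall t, a <= t <= b -> f t = 0) -> RInt f a b = 0.
Proof.
  intros Hab H; rewrite (RInt_ext f (fun _ => 0)).
  - rewrite RInt_const; apply Rmult_0_r.
  - intros t; rewrite Rmin_left, Rmax_right by lra; intros; apply H; lra.
Qed.

Lemma RInt_ext_le (f g : R -> R) (a b : R) :
  a <= b -> (forall t, a <= t <= b -> f t = g t) -> RInt f a b = RInt g a b.
Proof.
  intros Hab H; apply RInt_ext; intros t; rewrite Rmin_left, Rmax_right by lra.
  intros; apply H; lra.
Qed.

Lemma RInt_ext_all (f g : R -> R) (a b : R) :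
  (forall t, f t = g t) -> RInt f a b = RInt g a b.
Proof. intros H; apply RInt_ext; auto. Qed.

Lemma eq_of_zero_derive (f : R -> R) (a b x y : R) :
  (forall t, a < t < b -> is_derive f t 0) -> a < x < b -> a < y < b -> f x = f y.
Proof.
  intros H Hx Hy.
  destruct (MVT_gen f x y (fun _ => 0)) as [c [_ Hc]].
  - intros t Ht; apply H; unfold Rmin, Rmax in Ht; destruct Rle_dec in Ht; lra.
  - intros t Ht; apply continuity_pt_ex_derive.
    exists 0; apply H; unfold Rmin, Rmax in Ht; destruct Rle_dec in Ht; lra.
  - lra.
Qed.

Lemma zero_at_left_end (f : R -> R) (a b : R) :
  a < b -> continuous f b -> (forall t, a < t < b -> f t = 0) -> f b = 0.
Proof.
  intros Hab Hf H; apply cond_eq; intros eps Heps.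
  apply (filterlim_locally f (f b)) with (eps := mkposreal eps Heps) in Hf.
  destruct Hf as [d Hd].
  pose (t := Rmax ((a + b) / 2) (b - d / 2)).
  assert (Hd0 := cond_pos d).
  assert (Ht : a < t < b /\ b - d < t).
  { unfold t, Rmax; destruct Rle_dec; lra. }
  specialize (Hd t).
  rewrite (H t) in Hd by apply Ht.
  rewrite Rabs_minus_sym; apply Hd.
  apply Rabs_def1; change (minus t b) with (t - b); lra.
Qed.

Lemma zero_at_right_end (f : R -> R) (a b : R) :
  a < b -> continuous f a -> (forall t, a < t < b -> f t = 0) -> f a = 0.
Proof.
  intros Hab Hf H.
  replace a with (- - a) by ring.
  apply (zero_at_left_end (fun t => f (- t)) (- b) (- a)); try lra.
  - apply (continuous_comp (fun t => - t) f); [cont|].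
    now rewrite Ropp_involutive.
  - intros; apply H; lra.
Qed.

Lemma derive_constant_zero (f f' : R -> R) (a b c : R) :
  a < b -> (forall x, is_derive f x (f' x)) -> (forall x, continuous f' x) ->
  (forall x, a <= x <= b -> f x = c) -> forall x, a <= x <= b -> f' x = 0.
Proof.
  intros Hab D C Hc.
  assert (Hin : forall x, a < x < b -> f' x = 0).
  { intros x Hx.
    rewrite <- (is_derive_unique f x (f' x)) by apply D.
    apply is_derive_unique.
    apply is_derive_ext_loc with (fun _ => c); [|apply (is_derive_const (V := R_NormedModule))].
    assert (Hd : 0 < Rmin (x - a) (b - x)) by (apply Rmin_glb_lt; lra).
    exists (mkposreal _ Hd); intros y Hy.
    symmetry; apply Hc.
    apply Rabs_def2 in Hy; simpl in Hy; unfold minus, plus, opp in Hy; simpl in Hy.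
    assert (Hl := Rmin_l (x - a) (b - x)); assert (Hr := Rmin_r (x - a) (b - x)); lra. }
  intros x Hx.
  destruct (Req_dec x a) as [->|Hxa].
  - now apply (zero_at_right_end f' a b).
  - destruct (Req_dec x b) as [->|Hxb].
    + now apply (zero_at_left_end f' a b).
    + apply Hin; lra.
Qed.

(** The primitive from [a] is nondecreasing with equal values at both ends, hence constant, and [f]
    is its derivative. *)
Lemma RInt_nonneg_zero (f : R -> R) (a b : R) :
  a < b -> (forall x, continuous f x) -> (forall x, a <= x <= b -> 0 <= f x) ->
  RInt f a b = 0 -> forall x, a <= x <= b -> f x = 0.
Proof.
  intros Hab Hf Hpos H0.
  assert (Hmono : forall x y, a <= x -> x <= y -> y <= b -> 0 <= RInt f x y).
  { intros x y Hx Hxy Hy; apply RInt_ge_0; [lra|now apply ex_RInt_cont|].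
    intros; apply Hpos; lra. }
  apply (derive_constant_zero (fun x => RInt f a x) f a b 0); auto.
  { intros; now apply is_derive_primitive. }
  intros x Hx.
  assert (E : RInt f a x + RInt f x b = RInt f a b)
    by (apply (RInt_Chasles f); now apply ex_RInt_cont).
  assert (0 <= RInt f a x) by (apply Hmono; lra).
  assert (0 <= RInt f x b) by (apply Hmono; lra). lra.
Qed.

(* [RInt] is typed in the carrier of a normed module, which [ring] does not see through. *)
Ltac eqR := match goal with |- ?a = ?b => change (@eq R a b) end.

Lemma Derive_of_is_derive (f : R -> R) (x d : R) :
  is_derive f x d -> Derive (fun t : R => f t) x = d.
Proof. exact (is_derive_unique f x d). Qed.

(** * The Robin problem on an interval *)

(* Inverse of [- d^2/dx^2] on [-l, l] with [f'(l) = sigma f(l)], [f'(-l) = - sigma f(-l)],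
   i.e. the operator of kernel
   [- |x - t| / 2 + (l / 2 - 1 / (2 sigma)) + sigma / (2 (1 - sigma l)) * x * t]. *)
Definition green (l sigma : R) (phi : R -> R) (x : R) : R :=
  RInt (fun t => t * phi t) (- l) x - x * RInt phi (- l) x
  + (l / 2 - / (2 * sigma) + x / 2) * RInt phi (- l) l
  + (sigma / (2 * (1 - sigma * l)) * x - / 2) * RInt (fun t => t * phi t) (- l) l.

Definition green' (l sigma : R) (phi : R -> R) (x : R) : R :=
  - RInt phi (- l) x + RInt phi (- l) l / 2
  + sigma / (2 * (1 - sigma * l)) * RInt (fun t => t * phi t) (- l) l.

Lemma is_derive_green l sigma (phi : R -> R) :
  (forall x, continuous phi x) ->
  forall x, is_derive (green l sigma phi) x (green' l sigma phi x).
Proof.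
  intros H x; unfold green, green'.
  assert (H0 := is_derive_primitive phi (- l) x H).
  assert (H1 := is_derive_primitive (fun t => t * phi t) (- l) x ltac:(cont)).
  revert H0 H1.
  generalize (RInt phi (- l)) (RInt (fun t => t * phi t) (- l)); intros F0 F1 H0 H1.
  evar_last.
  { auto_derive; [repeat split; eexists; eassumption|reflexivity]. }
  rewrite (Derive_of_is_derive _ _ _ H0), (Derive_of_is_derive _ _ _ H1).
  unfold Rdiv; ring.
Qed.

Lemma is_derive_green' l sigma (phi : R -> R) :
  (forall x, continuous phi x) ->
  forall x, is_derive (green' l sigma phi) x (- phi x).
Proof.
  intros H x; unfold green'.
  assert (H0 := is_derive_primitive phi (- l) x H).
  revert H0; generalize (RInt phi (- l)); intros F0 H0.
  evar_last.
  { auto_derive; [repeat split; eexists; eassumption|reflexivity]. }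
  rewrite (Derive_of_is_derive _ _ _ H0); ring.
Qed.

Lemma continuous_green l sigma (phi : R -> R) :
  (forall x, continuous phi x) -> forall x, continuous (green l sigma phi) x.
Proof. intros H; eapply continuous_of_is_derive; now apply is_derive_green. Qed.

Lemma continuous_green' l sigma (phi : R -> R) :
  (forall x, continuous phi x) -> forall x, continuous (green' l sigma phi) x.
Proof.
  intros H; apply (continuous_of_is_derive _ (fun x => - phi x)).
  now apply is_derive_green'.
Qed.

Lemma green_robin_right l sigma (phi : R -> R) :
  sigma <> 0 -> 1 - sigma * l <> 0 ->
  green' l sigma phi l = sigma * green l sigma phi l.
Proof. intros H1 H2; unfold green, green'; field; auto. Qed.

Lemma green_robin_left l sigma (phi : R -> R) :
  sigma <> 0 -> 1 - sigma * l <> 0 ->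
  green' l sigma phi (- l) = - (sigma * green l sigma phi (- l)).
Proof.
  intros H1 H2; unfold green, green'.
  rewrite !RInt_point; unfold zero; simpl; field; auto.
Qed.

Lemma green_ext l sigma (phi psi : R -> R) :
  0 < l -> (forall t, - l <= t <= l -> phi t = psi t) ->
  forall x, - l <= x <= l -> green l sigma phi x = green l sigma psi x.
Proof.
  intros Hl H x Hx; unfold green.
  assert (E : forall y, - l <= y <= l -> RInt phi (- l) y = RInt psi (- l) y).
  { intros y Hy; apply RInt_ext_le; [lra|]; intros; apply H; lra. }
  assert (E' : forall y, - l <= y <= l ->
    RInt (fun t => t * phi t) (- l) y = RInt (fun t => t * psi t) (- l) y).
  { intros y Hy; apply RInt_ext_le; [lra|]; intros; rewrite H; lra. }
  rewrite (E x), (E' x), (E l), (E' l) by lra; reflexivity.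
Qed.

Lemma green_lin l sigma (phi psi : R -> R) k x :
  (forall x, continuous phi x) -> (forall x, continuous psi x) ->
  green l sigma (fun t => phi t + k * psi t) x
  = green l sigma phi x + k * green l sigma psi x.
Proof.
  intros H1 H2; unfold green.
  assert (E : forall y, RInt (fun t => phi t + k * psi t) (- l) y
    = RInt phi (- l) y + k * RInt psi (- l) y).
  { intros y; rewrite RInt_Rplus, RInt_Rscal by cont; reflexivity. }
  assert (E' : forall y, RInt (fun t => t * (phi t + k * psi t)) (- l) y
    = RInt (fun t => t * phi t) (- l) y + k * RInt (fun t => t * psi t) (- l) y).
  { intros y; rewrite <- RInt_Rscal, <- RInt_Rplus by cont.
    apply RInt_ext_all; intros; ring. }
  rewrite !E, !E'; ring.
Qed.

(** The difference with the Green solution is affine, [k * x + c]; the two Robin conditions give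
    [2 * sigma * c = 0] and [(1 - sigma * l) * k = 0]. At the ends [g1] is only required to be
    continuous, not to be a derivative of [g], since the normal derivatives of an eigenfunction are
    known only as limits. *)
Lemma green_unique l sigma (phi : R -> R) (g g1 : R -> R) :
  0 < l -> sigma <> 0 -> 1 - sigma * l <> 0 ->
  (forall x, continuous phi x) -> (forall x, continuous g x) ->
  continuous g1 l -> continuous g1 (- l) ->
  (forall x, - l < x < l -> is_derive g x (g1 x)) ->
  (forall x, - l < x < l -> is_derive g1 x (- phi x)) ->
  g1 l = sigma * g l -> g1 (- l) = - (sigma * g (- l)) ->
  forall x, - l <= x <= l -> g x = green l sigma phi x.
Proof.
  intros Hl Hs Hsl Hphi Hg Hg1 Hg1' Dg Dg1 Rr Rl.
  pose (z := fun x => g x - green l sigma phi x).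
  pose (z1 := fun x => g1 x - green' l sigma phi x).
  assert (Cz : forall x, continuous z x).
  { assert (C := continuous_green l sigma phi Hphi). unfold z; cont. }
  assert (Dz : forall x, - l < x < l -> is_derive z x (z1 x)).
  { intros x Hx; apply (is_derive_minus (V := R_NormedModule)); [now apply Dg|].
    now apply is_derive_green. }
  assert (Dz1 : forall x, - l < x < l -> is_derive z1 x 0).
  { intros x Hx; evar_last.
    - apply (is_derive_minus (V := R_NormedModule)); [now apply Dg1|].
      now apply is_derive_green'.
    - unfold minus, plus, opp; simpl; ring. }
  pose (k := z1 0). pose (c := z 0).
  assert (Hz1 : forall x, - l < x < l -> z1 x = k).
  { intros x Hx; apply (eq_of_zero_derive z1 (- l) l); auto; lra. }
  assert (Hz : forall x, - l < x < l -> z x - k * x - c = 0).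
  { intros x Hx.
    assert (E : z x - k * x = z 0 - k * 0).
    { apply (eq_of_zero_derive (fun x => z x - k * x) (- l) l); try lra.
      intros t Ht; assert (D := Dz t Ht); evar_last.
      - auto_derive; [repeat split; eexists; exact D|reflexivity].
      - rewrite (Derive_of_is_derive _ _ _ D), Hz1 by lra; ring. }
    unfold c; lra. }
  assert (Hz_l : z l - k * l - c = 0).
  { apply (zero_at_left_end (fun x => z x - k * x - c) (- l) l); auto; [lra|cont]. }
  assert (Hz_ml : z (- l) - k * (- l) - c = 0).
  { apply (zero_at_right_end (fun x => z x - k * x - c) (- l) l); auto; [lra|cont]. }
  assert (C := continuous_green' l sigma phi Hphi).
  assert (Hz1_l : z1 l - k = 0).
  { apply (zero_at_left_end (fun x => z1 x - k) (- l) l); [lra|unfold z1; cont|].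
    intros; rewrite Hz1; lra. }
  assert (Hz1_ml : z1 (- l) - k = 0).
  { apply (zero_at_right_end (fun x => z1 x - k) (- l) l); [lra|unfold z1; cont|].
    intros; rewrite Hz1; lra. }
  assert (Hzr : z1 l = sigma * z l).
  { unfold z, z1; rewrite Rr, green_robin_right by auto; ring. }
  assert (Hzl : z1 (- l) = - (sigma * z (- l))).
  { unfold z, z1; rewrite Rl, green_robin_left by auto; ring. }
  assert (Hc : c = 0).
  { apply (Rmult_eq_reg_l (2 * sigma)); [|lra].
    replace (z l) with (k * l + c) in Hzr by lra.
    replace (z (- l)) with (c - k * l) in Hzl by lra. lra. }
  assert (Hk : k = 0).
  { apply (Rmult_eq_reg_l (1 - sigma * l)); [|lra].
    replace (z l) with (k * l + c) in Hzr by lra. rewrite Hc in Hzr. lra. }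
  intros x Hx; enough (z x = 0) by (unfold z in *; lra).
  destruct (Req_dec x l) as [->|]; [rewrite Hk, Hc in *; lra|].
  destruct (Req_dec x (- l)) as [->|]; [rewrite Hk, Hc in *; lra|].
  specialize (Hz x ltac:(lra)); rewrite Hk, Hc in *; lra.
Qed.

(** The difference of the integrands is the derivative of the Wronskian [w], which vanishes at both
    ends because both solutions satisfy the same Robin conditions. *)
Lemma green_sym l sigma (phi psi : R -> R) :
  0 < l -> sigma <> 0 -> 1 - sigma * l <> 0 ->
  (forall x, continuous phi x) -> (forall x, continuous psi x) ->
  RInt (fun t => green l sigma phi t * psi t) (- l) l
  = RInt (fun t => phi t * green l sigma psi t) (- l) l.
Proof.
  intros Hl Hs Hsl Hf Hg.
  assert (Cf := continuous_green l sigma phi Hf).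
  assert (Cg := continuous_green l sigma psi Hg).
  apply Rminus_diag_uniq; rewrite <- RInt_Rminus by cont.
  pose (w := fun x => green' l sigma phi x * green l sigma psi x
                      - green l sigma phi x * green' l sigma psi x).
  rewrite (RInt_ftc w).
  - unfold w; rewrite !green_robin_left, !green_robin_right by auto; ring.
  - intros x _; unfold w.
    assert (Df := is_derive_green l sigma phi Hf x).
    assert (Dg := is_derive_green l sigma psi Hg x).
    assert (Df' := is_derive_green' l sigma phi Hf x).
    assert (Dg' := is_derive_green' l sigma psi Hg x).
    revert Df Dg Df' Dg'.
    generalize (green l sigma phi) (green l sigma psi) (green' l sigma phi)
      (green' l sigma psi); intros f g f' g' Df Dg Df' Dg'.
    evar_last.
    { auto_derive; [repeat split; eexists; eassumption|reflexivity]. }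
    rewrite (Derive_of_is_derive _ _ _ Df), (Derive_of_is_derive _ _ _ Dg),
      (Derive_of_is_derive _ _ _ Df'), (Derive_of_is_derive _ _ _ Dg'); ring.
  - cont.
Qed.

(** * Integrals depending on a parameter *)

Lemma continuity_2d_swap (f : R -> R -> R) (x y : R) :
  continuity_2d_pt f x y -> continuity_2d_pt (fun u v => f v u) y x.
Proof.
  intros H eps; destruct (H eps) as [d Hd]; exists d; auto.
Qed.

Lemma continuous_slice_1 (f : R -> R -> R) (x y : R) :
  continuity_2d_pt f x y -> continuous (fun u => f u y) x.
Proof.
  intros H; apply filterlim_locally; intros eps.
  destruct (H eps) as [d Hd]; exists d; intros u Hu.
  apply Hd; [exact Hu|].
  rewrite Rminus_eq_0, Rabs_R0; apply cond_pos.
Qed.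

Lemma continuous_slice_2 (f : R -> R -> R) (x y : R) :
  continuity_2d_pt f x y -> continuous (fun v => f x v) y.
Proof.
  intros H; apply (continuous_slice_1 (fun u v => f v u)).
  now apply continuity_2d_swap.
Qed.

Lemma continuity_2d_fst (f : R -> R) (x y : R) :
  continuous f x -> continuity_2d_pt (fun u _ => f u) x y.
Proof.
  intros H; apply (continuity_1d_2d_pt_comp f (fun u _ => u)).
  - now apply continuity_pt_filterlim.
  - apply continuity_2d_pt_id1.
Qed.

Lemma continuity_2d_snd (f : R -> R) (x y : R) :
  continuous f y -> continuity_2d_pt (fun _ v => f v) x y.
Proof.
  intros H; apply (continuity_1d_2d_pt_comp f (fun _ v => v)).
  - now apply continuity_pt_filterlim.
  - apply continuity_2d_pt_id2.
Qed.

Lemma continuity_2d_comp (f : R -> R -> R) (g h : R -> R -> R) (x y : R) :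
  continuity_2d_pt f (g x y) (h x y) ->
  continuity_2d_pt g x y -> continuity_2d_pt h x y ->
  continuity_2d_pt (fun u v => f (g u v) (h u v)) x y.
Proof.
  intros Hf Hg Hh eps; destruct (Hf eps) as [d Hd].
  destruct (Hg d) as [d1 H1]; destruct (Hh d) as [d2 H2].
  assert (Hm : 0 < Rmin d1 d2) by (apply Rmin_glb_lt; apply cond_pos).
  exists (mkposreal _ Hm); simpl; intros u v Hu Hv.
  apply Hd; [apply H1|apply H2]; eapply Rlt_le_trans; eauto using Rmin_l, Rmin_r.
Qed.

Ltac cont2 :=
  lazymatch goal with
  | |- forall _, _ => intro; cont2
  | |- continuity_2d_pt (fun _ _ => ?c) _ _ => apply continuity_2d_pt_const
  | |- continuity_2d_pt (fun u _ => @?f u) _ _ => apply (continuity_2d_fst f); cont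
  | |- continuity_2d_pt (fun _ v => @?f v) _ _ => apply (continuity_2d_snd f); cont
  | |- continuity_2d_pt (fun u v => @?f u v + @?g u v) _ _ =>
      apply (continuity_2d_pt_plus f g); cont2
  | |- continuity_2d_pt (fun u v => @?f u v - @?g u v) _ _ =>
      apply (continuity_2d_pt_minus f g); cont2
  | |- continuity_2d_pt (fun u v => @?f u v * @?g u v) _ _ =>
      apply (continuity_2d_pt_mult f g); cont2
  | |- continuity_2d_pt (fun u v => - @?f u v) _ _ => apply (continuity_2d_pt_opp f); cont2
  | H : forall x y, continuity_2d_pt ?f x y |- continuity_2d_pt (fun u v => ?f v u) _ _ =>
      apply continuity_2d_swap, H
  | H : forall x y, continuity_2d_pt ?f x y
    |- continuity_2d_pt (fun u v => ?f (@?g u v) (@?h u v)) _ _ =>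
      apply (continuity_2d_comp f g h); [apply H|cont2|cont2]
  | |- _ => auto
  end.

Lemma continuous_RInt_param (k : R -> R -> R) (a b y : R) :
  a <= b -> (forall u t, a <= t <= b -> continuity_2d_pt k u t) ->
  continuous (fun u => RInt (fun t => k u t) a b) y.
Proof.
  intros Hab Hk.
  assert (Hex : forall u, ex_RInt (fun t => k u t) a b).
  { intros u; apply (ex_RInt_continuous (V := R_CompleteNormedModule)).
    intros t Ht; rewrite Rmin_left, Rmax_right in Ht by lra.
    now apply continuous_slice_2, Hk. }
  apply filterlim_locally; intros [e He].
  assert (He' : 0 < e / (b - a + 1)) by (apply Rdiv_lt_0_compat; lra).
  destruct (uniform_continuity_2d_1d' k a b y (fun t Ht => Hk y t Ht) (mkposreal _ He'))
    as [d Hd]; simpl in Hd.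
  exists d; intros u Hu.
  apply Rabs_def2 in Hu; change (minus u y) with (u - y) in Hu.
  change (Rabs (RInt (fun t => k u t) a b - RInt (fun t => k y t) a b) < e).
  rewrite <- (RInt_minus (V := R_CompleteNormedModule)
    (fun t => k u t) (fun t => k y t)) by auto.
  eapply Rle_lt_trans.
  - apply (abs_RInt_le_const _ a b (e / (b - a + 1))); [lra| |].
    + now apply (ex_RInt_minus (V := R_NormedModule)).
    + intros t Ht; left; apply (Hd t y t u); try lra.
      rewrite Rminus_eq_0, Rabs_R0; apply cond_pos.
  - apply Rlt_le_trans with ((b - a + 1) * (e / (b - a + 1))).
    + apply Rmult_lt_compat_r; lra.
    + right; field; lra.
Qed.

Lemma continuity_2d_primitive (k : R -> R -> R) (c : R) :
  (forall x y, continuity_2d_pt k x y) ->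
  forall x y, continuity_2d_pt (fun x y => RInt (fun t => k t y) c x) x y.
Proof.
  intros Hk x0 y0 [e He].
  assert (Hex : forall y a b, ex_RInt (fun t => k t y) a b).
  { intros y a b; apply ex_RInt_cont; intros t; now apply continuous_slice_1. }
  assert (Hslice : continuous (fun y => RInt (fun t => k t y) c x0) y0).
  { destruct (Rle_dec c x0) as [Hc|Hc].
    - apply (continuous_RInt_param (fun y t => k t y)); auto.
      intros; now apply continuity_2d_swap.
    - apply continuous_ext with (fun y => - RInt (fun t => k t y) x0 c).
      + intros y; apply (opp_RInt_swap (V := R_CompleteNormedModule)), Hex.
      + apply continuous_Ropp, (continuous_RInt_param (fun y t => k t y)); [lra|].
        intros; now apply continuity_2d_swap. }
  assert (He2 : 0 < e / 2) by lra.
  apply filterlim_locally with (eps := mkposreal _ He2) in Hslice.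
  destruct Hslice as [d1 H1].
  destruct (Hk x0 y0 (mkposreal 1 Rlt_0_1)) as [d2 H2]; simpl in H2.
  (* [M] bounds [k] near [(x0, y0)], so moving the upper limit from [x0] to [u] costs at most
     [M * Rabs (u - x0)]. *)
  pose (M := Rabs (k x0 y0) + 1).
  assert (HM : 0 < M) by (assert (P := Rabs_pos (k x0 y0)); unfold M; lra).
  assert (Hd : 0 < Rmin (Rmin d1 d2) (e / 2 / M)).
  { repeat apply Rmin_glb_lt; try apply cond_pos; now apply Rdiv_lt_0_compat. }
  exists (mkposreal _ Hd); simpl; intros u v Hu Hv.
  assert (Q1 := Rmin_l (Rmin d1 d2) (e / 2 / M)).
  assert (Q2 := Rmin_r (Rmin d1 d2) (e / 2 / M)).
  assert (Q3 := Rmin_l d1 d2); assert (Q4 := Rmin_r d1 d2).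
  assert (A1 : Rabs (RInt (fun t => k t v) c x0 - RInt (fun t => k t y0) c x0) < e / 2).
  { apply H1; apply Rlt_le_trans with (1 := Hv); lra. }
  assert (A2 : Rabs (RInt (fun t => k t v) x0 u) < e / 2).
  { apply Rle_lt_trans with (Rabs (u - x0) * M).
    - apply (norm_RInt_le_const_abs (V := R_NormedModule) (fun t => k t v) x0 u).
      + intros t Ht; change (Rabs (k t v) <= M).
        replace (k t v) with (k x0 y0 + (k t v - k x0 y0)) by ring.
        eapply Rle_trans; [apply Rabs_triang|]; apply Rplus_le_compat_l; left.
        apply H2; [|lra].
        eapply Rle_lt_trans; [|eapply Rlt_le_trans; [exact Hu|lra]].
        unfold Rmin, Rmax in Ht; destruct (Rle_dec x0 u);
          unfold Rabs; repeat destruct Rcase_abs; lra.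
      + now apply (RInt_correct (V := R_CompleteNormedModule)).
    - apply Rlt_le_trans with (e / 2 / M * M); [|right; field; lra].
      apply Rmult_lt_compat_r; lra. }
  rewrite <- (RInt_Chasles (fun t => k t v) c x0 u) by auto.
  unfold plus; simpl.
  replace (_ + _ - _) with ((RInt (fun t => k t v) c x0 - RInt (fun t => k t y0) c x0)
    + RInt (fun t => k t v) x0 u) by ring.
  eapply Rle_lt_trans; [apply Rabs_triang|lra].
Qed.

(** The margin between [[a, b]] and [(a', b')] serves the joint continuity of the derivative, a
    condition on a full neighbourhood of each point, the ends of [[a, b]] included. *)
Lemma is_derive_RInt_param_strip (f f' : R -> R -> R) (y0 y1 a' a b b' y : R) :
  a' < a -> a <= b -> b < b' -> y0 < y < y1 ->
  (forall u t, y0 < u < y1 -> a' < t < b' -> continuity_2d_pt f u t) ->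
  (forall u t, y0 < u < y1 -> a' < t < b' -> continuity_2d_pt f' u t) ->
  (forall u t, y0 < u < y1 -> a' < t < b' -> is_derive (fun z => f z t) u (f' u t)) ->
  is_derive (fun u => RInt (fun t => f u t) a b) y (RInt (fun t => f' y t) a b).
Proof.
  intros Ha Hab Hb Hy Cf Cf' D.
  assert (Hm : 0 < Rmin (y - y0) (y1 - y)) by (apply Rmin_glb_lt; lra).
  assert (Hloc : forall u, Rabs (u - y) < Rmin (y - y0) (y1 - y) -> y0 < u < y1).
  { intros u Hu; apply Rabs_def2 in Hu.
    assert (Q1 := Rmin_l (y - y0) (y1 - y)); assert (Q2 := Rmin_r (y - y0) (y1 - y)).
    lra. }
  rewrite (RInt_ext_le _ (fun t => Derive (fun u => f u t) y) a b); [|lra|].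
  2: { intros t Ht; symmetry; apply Derive_of_is_derive, D; lra. }
  apply is_derive_RInt_param.
  - exists (mkposreal _ Hm); intros u Hu t; rewrite Rmin_left, Rmax_right by lra.
    intros Ht; exists (f' u t); apply D; [apply Hloc, Hu|lra].
  - intros t; rewrite Rmin_left, Rmax_right by lra; intros Ht.
    apply continuity_2d_pt_ext_loc with f'; [|apply Cf'; lra].
    assert (Hm2 : 0 < Rmin (Rmin (y - y0) (y1 - y)) (Rmin (a - a') (b' - b)))
      by (repeat apply Rmin_glb_lt; lra).
    exists (mkposreal _ Hm2); simpl; intros u v Hu Hv.
    symmetry; apply Derive_of_is_derive, D.
    + apply Hloc; eapply Rlt_le_trans; [exact Hu|apply Rmin_l].
    + apply Rabs_def2 in Hv.
      assert (Q := Rmin_r (Rmin (y - y0) (y1 - y)) (Rmin (a - a') (b' - b))).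
      assert (Q1 := Rmin_l (a - a') (b' - b)); assert (Q2 := Rmin_r (a - a') (b' - b)).
      lra.
  - exists (mkposreal _ Hm); intros u Hu.
    apply (ex_RInt_continuous (V := R_CompleteNormedModule)).
    intros t; rewrite Rmin_left, Rmax_right by lra; intros Ht.
    apply continuous_slice_2, Cf; [apply Hloc, Hu|lra].
Qed.

(** Both sides vanish at [d = c] and have the same derivative with respect to the upper limit
    [d]. *)
Lemma RInt_swap_order (f : R -> R -> R) (a b c d : R) :
  a <= b -> c <= d -> (forall x y, continuity_2d_pt f x y) ->
  RInt (fun x => RInt (fun y => f x y) c d) a b
  = RInt (fun y => RInt (fun x => f x y) a b) c d.
Proof.
  intros Hab Hcd Hf.
  assert (Hf' : forall x y, continuity_2d_pt (fun y x => f x y) x y)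
    by (intros; now apply continuity_2d_swap).
  assert (Ci : forall y, continuous (fun y => RInt (fun x => f x y) a b) y).
  { intros y; apply (continuous_RInt_param (fun y x => f x y)); auto. }
  pose (F := fun z => RInt (fun x => RInt (fun y => f x y) c z) a b
                      - RInt (fun y => RInt (fun x => f x y) a b) c z).
  assert (DF : forall z, is_derive F z 0).
  { intros z; evar_last.
    - apply (is_derive_minus (V := R_NormedModule)).
      + apply (is_derive_RInt_param_strip (fun z x => RInt (fun y => f x y) c z)
          (fun z x => f x z) (z - 1) (z + 1) (a - 1) a b (b + 1)); try lra.
        * intros u t _ _.
          now apply (continuity_2d_primitive (fun y x => f x y) c).
        * auto.
        * intros u t _ _; apply is_derive_primitive.
          intros y; now apply continuous_slice_2.
      + apply is_derive_primitive; exact Ci.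
    - unfold minus, plus, opp; simpl; ring. }
  assert (E : F d = F c).
  { destruct (Req_dec c d) as [->|Hne]; [reflexivity|].
    symmetry; apply (eq_is_derive (V := R_NormedModule)); [|lra].
    intros t _; apply DF. }
  unfold F in E; rewrite !RInt_point in E.
  rewrite (RInt_zero_fun (fun x => RInt (fun y => f x y) c c)) in E;
    [|lra|intros t Ht; rewrite RInt_point; reflexivity].
  unfold zero in E; simpl in E; lra.
Qed.

(** * From the Steklov problem to an integral equation *)

(* [V] is the [y]-derivative of [S] in the open rectangle, extended
   continuously to the whole strip [-l < x < l]. *)
Definition steklov_strip (l m sigma : R) (S V Vy : R -> R -> R) : Prop :=
  (forall x y, - l < x < l -> continuity_2d_pt V x y) /\
  (forall x y, - l < x < l -> - m < y < m ->
     is_derive (fun z => S x z) y (V x y) /\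
     is_derive (fun z => V x z) y (Vy x y) /\ continuity_2d_pt Vy x y) /\
  (forall x, - l < x < l ->
     V x m = sigma * S x m /\ V x (- m) = - (sigma * S x (- m))).

(** [U] and [Ux], the first and second [x]-derivatives, take [y] as first argument. This makes the
    data symmetric under exchange of the variables, so that each statement about one direction also
    serves the other. *)
Definition steklov_data (l m sigma : R) (S : R -> R -> R) : Prop :=
  (forall x y, continuity_2d_pt S x y) /\
  exists V Vy U Ux : R -> R -> R,
    steklov_strip l m sigma S V Vy /\
    steklov_strip m l sigma (fun y x => S x y) U Ux /\
    (forall x y, - l < x < l -> - m < y < m -> Vy x y + Ux y x = 0).

Lemma steklov_data_swap l m sigma (S : R -> R -> R) :
  steklov_data l m sigma S -> steklov_data m l sigma (fun y x => S x y).
Proof.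
  intros [C (V & Vy & U & Ux & HV & HU & E)]; split.
  - intros; now apply continuity_2d_swap.
  - exists U, Ux, V, Vy; split; [exact HU|split; [exact HV|]].
    intros; rewrite Rplus_comm; auto.
Qed.

Ltac comp2 H :=
  lazymatch goal with
  | |- continuity_2d_pt (fun u v => ?f (@?g u v) (@?h u v)) _ _ =>
      apply (continuity_2d_comp f g h); [apply H; cbv beta; lra|cont2|cont2]
  end.

(** This is the integrated form of [(T_m s)_xx = s], with the Taylor remainder weight [h - t]. The
    right side, as a function of [y], is shown to solve the Robin problem whose source is the second
    difference [phi] of [S]; uniqueness then identifies it with [T_m phi]. Up to the sides only [V]
    is needed; harmonicity is used at interior [y] alone. *)
Lemma second_difference_green_across l m sigma (S : R -> R -> R) x h y :
  0 < m -> sigma <> 0 -> 1 - sigma * m <> 0 -> steklov_data l m sigma S ->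
  0 < h -> - l < x - h -> x + h < l -> - m <= y <= m ->
  green m sigma (S (x + h)) y + green m sigma (S (x - h)) y - 2 * green m sigma (S x) y
  = RInt (fun t => (h - t) * (S (x + t) y + S (x - t) y)) 0 h.
Proof.
  intros Hm Hs Hsm [C (V & Vy & U & Ux & (CV & DV & RV) & (CU & DU & RU) & E)] Hh Hx1 Hx2 Hy.
  assert (Cs : forall x y, continuous (fun y => S x y) y)
    by (intros; now apply continuous_slice_2).
  assert (Cs1 : forall x, forall y, continuous (S x) y) by exact Cs.
  pose (phi := fun y => S (x + h) y + S (x - h) y - 2 * S x y).
  assert (Cphi : forall y, continuous phi y) by (unfold phi; cont).
  transitivity (green m sigma phi y).
  { transitivity (green m sigma (fun y => (S (x + h) y + 1 * S (x - h) y) + (-2) * S x y) y).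
    - rewrite !green_lin by cont. ring.
    - apply green_ext; auto; intros; unfold phi; ring. }
  assert (CVy : forall x y, - l < x < l -> - m < y < m -> continuity_2d_pt Vy x y)
    by (intros; now apply DV).
  assert (CI : forall y, forall t, continuous (fun t => (h - t) * (S (x + t) y + S (x - t) y)) t).
  { intros z t.
    apply (continuous_slice_1 (fun t z => (h - t) * (S (x + t) z + S (x - t) z))); cont2. }
  (* For [t] in [(- r, r)], an open interval containing [[0, h]], both [x + t] and [x - t] stay in
     [(- l, l)]. *)
  pose (r := Rmin (l - x) (x + l)).
  assert (Hr : h < r) by (apply Rmin_glb_lt; lra).
  assert (Hr1 := Rmin_l (l - x) (x + l)); assert (Hr2 := Rmin_r (l - x) (x + l)).
  fold r in Hr1, Hr2.
  symmetry.
  apply (green_unique m sigma phi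
    (fun y => RInt (fun t => (h - t) * (S (x + t) y + S (x - t) y)) 0 h)
    (fun y => RInt (fun t => (h - t) * (V (x + t) y + V (x - t) y)) 0 h)); auto.
  - intros z.
    apply (continuous_RInt_param (fun y t => (h - t) * (S (x + t) y + S (x - t) y)));
      [lra|]; intros; cont2.
  - apply (continuous_RInt_param (fun y t => (h - t) * (V (x + t) y + V (x - t) y)));
      [lra|]; intros; cont2; comp2 CV.
  - apply (continuous_RInt_param (fun y t => (h - t) * (V (x + t) y + V (x - t) y)));
      [lra|]; intros; cont2; comp2 CV.
  - intros z Hz.
    apply (is_derive_RInt_param_strip (fun y t => (h - t) * (S (x + t) y + S (x - t) y))
      (fun y t => (h - t) * (V (x + t) y + V (x - t) y)) (- m) m (- r) 0 h r); try lra.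
    + intros; cont2.
    + intros; cont2; comp2 CV.
    + intros u t Hu Ht.
      assert (D1 := proj1 (DV (x + t) u ltac:(lra) ltac:(lra))).
      assert (D2 := proj1 (DV (x - t) u ltac:(lra) ltac:(lra))).
      evar_last.
      { auto_derive; [repeat split; eexists; eassumption|reflexivity]. }
      rewrite (Derive_of_is_derive _ _ _ D1), (Derive_of_is_derive _ _ _ D2); ring.
  - intros z Hz; evar_last.
    + apply (is_derive_RInt_param_strip (fun y t => (h - t) * (V (x + t) y + V (x - t) y))
        (fun y t => (h - t) * (Vy (x + t) y + Vy (x - t) y)) (- m) m (- r) 0 h r); try lra.
      * intros; cont2; comp2 CV.
      * intros; cont2; comp2 CVy.
      * intros u t Hu Ht.
        assert (D1 := proj1 (proj2 (DV (x + t) u ltac:(lra) ltac:(lra)))).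
        assert (D2 := proj1 (proj2 (DV (x - t) u ltac:(lra) ltac:(lra)))).
        evar_last.
        { auto_derive; [repeat split; eexists; eassumption|reflexivity]. }
        rewrite (Derive_of_is_derive _ _ _ D1), (Derive_of_is_derive _ _ _ D2); ring.
    (* Harmonicity replaces [Vy] by [- Ux], and integrating by parts twice in [t] gives this
       antiderivative; between 0 and [h] it changes by [- phi]. *)
    + assert (F := RInt_ftc
        (fun t => - ((h - t) * (U z (x + t) - U z (x - t)) + S (x + t) z + S (x - t) z))
        (fun t => (h - t) * (Vy (x + t) z + Vy (x - t) z)) 0 h).
      rewrite F.
      * unfold phi; replace (x + 0) with x by ring; replace (x - 0) with x by ring; ring.
      * intros t; rewrite Rmin_left, Rmax_right by lra; intros Ht.
        destruct (DU z (x + t) ltac:(lra) ltac:(lra)) as [D1 [D2 _]].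
        destruct (DU z (x - t) ltac:(lra) ltac:(lra)) as [D3 [D4 _]].
        evar_last.
        { auto_derive; [repeat split; eexists; eassumption|reflexivity]. }
        change (x + - t) with (x - t).
        rewrite (Derive_of_is_derive _ _ _ D1), (Derive_of_is_derive _ _ _ D2),
          (Derive_of_is_derive _ _ _ D3), (Derive_of_is_derive _ _ _ D4).
        assert (E1 := E (x + t) z ltac:(lra) ltac:(lra)).
        assert (E2 := E (x - t) z ltac:(lra) ltac:(lra)).
        replace (Vy (x + t) z) with (- Ux z (x + t)) by lra.
        replace (Vy (x - t) z) with (- Ux z (x - t)) by lra. ring.
      * intros t; rewrite Rmin_left, Rmax_right by lra; intros Ht.
        apply (continuous_slice_1 (fun t z => (h - t) * (Vy (x + t) z + Vy (x - t) z))).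
        cont2; comp2 CVy.
  - rewrite <- RInt_Rscal by apply CI; apply RInt_ext_le; [lra|]; intros t Ht.
    rewrite !(fun x H => proj1 (RV x H)) by lra; ring.
  - replace (- (_ * _)) with ((- sigma) * RInt (fun t => (h - t) * (S (x + t) (- m) + S (x - t) (- m))) 0 h) by ring.
    rewrite <- RInt_Rscal by apply CI; apply RInt_ext_le; [lra|]; intros t Ht.
    rewrite !(fun x H => proj2 (RV x H)) by lra; ring.
Qed.

Lemma second_difference_green_along l sigma (phi : R -> R) x h :
  0 < h -> (forall x, continuous phi x) ->
  green l sigma phi (x + h) + green l sigma phi (x - h) - 2 * green l sigma phi x
  = - RInt (fun t => (h - t) * (phi (x + t) + phi (x - t))) 0 h.
Proof.
  intros Hh C.
  assert (D := is_derive_green l sigma phi C).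
  assert (D' := is_derive_green' l sigma phi C).
  rewrite (RInt_ftc (fun t => - ((h - t) * (green' l sigma phi (x + t) - green' l sigma phi (x - t))
    + green l sigma phi (x + t) + green l sigma phi (x - t)))).
  - replace (x + 0) with x by ring; replace (x - 0) with x by ring; ring.
  - intros t _; specialize (D (x + t)) as D1; specialize (D (x - t)) as D2.
    specialize (D' (x + t)) as D3; specialize (D' (x - t)) as D4.
    revert D1 D2 D3 D4; generalize (green l sigma phi) (green' l sigma phi).
    intros f f' D1 D2 D3 D4; evar_last.
    { auto_derive; [repeat split; eexists; eassumption|reflexivity]. }
    change (x + - t) with (x - t).
    rewrite (Derive_of_is_derive _ _ _ D1), (Derive_of_is_derive _ _ _ D2),
      (Derive_of_is_derive _ _ _ D3), (Derive_of_is_derive _ _ _ D4); ring.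
  - cont.
Qed.

(** * Vanishing second differences and bilinearity *)

Definition second_difference_zero (l : R) (f : R -> R) : Prop :=
  forall x h, 0 < h -> - l < x - h -> x + h < l -> f (x + h) + f (x - h) - 2 * f x = 0.

(** A maximum principle. If the maximum is attained at an interior [X], let [h] be the distance to
    the nearer end: [f X] is the mean of an end value, which is 0, and of another value that is at
    most [f X], whence [f X <= 0]. *)
Lemma second_difference_zero_le l (f : R -> R) :
  0 < l -> (forall x, continuous f x) -> second_difference_zero l f ->
  f l = 0 -> f (- l) = 0 -> forall x, - l <= x <= l -> f x <= 0.
Proof.
  intros Hl C H Hr Hml x Hx.
  destruct (continuity_ab_maj f (- l) l) as [X [HX HXl]]; [lra| |].
  { intros; apply continuity_pt_filterlim, C. }
  apply Rle_trans with (f X); [now apply HX|].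
  destruct (Req_dec X l) as [->|]; [lra|].
  destruct (Req_dec X (- l)) as [->|]; [lra|].
  pose (h := Rmin (l - X) (X + l)).
  assert (Hh : 0 < h) by (apply Rmin_glb_lt; lra).
  assert (Q1 := Rmin_l (l - X) (X + l)); assert (Q2 := Rmin_r (l - X) (X + l)).
  fold h in Q1, Q2.
  (* The definition excludes points at the ends, so the identity for this [h] is a limit from
     smaller steps. *)
  assert (E : f (X + h) + f (X - h) - 2 * f X = 0).
  { apply (zero_at_left_end (fun h => f (X + h) + f (X - h) - 2 * f X) 0 h); auto.
    - cont.
    - intros t Ht; apply H; lra. }
  assert (B1 : f (X + h) <= f X) by (apply HX; lra).
  assert (B2 : f (X - h) <= f X) by (apply HX; lra).
  destruct (Rle_dec (l - X) (X + l)) as [Hc|Hc].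
  - replace (X + h) with l in * by (unfold h; rewrite Rmin_left; lra). lra.
  - replace (X - h) with (- l) in * by (unfold h; rewrite Rmin_right; lra). lra.
Qed.

Lemma second_difference_zero_affine l (f : R -> R) :
  0 < l -> (forall x, continuous f x) -> second_difference_zero l f ->
  forall x, - l <= x <= l ->
  f x = (f l + f (- l)) / 2 + (f l - f (- l)) / (2 * l) * x.
Proof.
  intros Hl C H x Hx.
  pose (k := fun x => (f l + f (- l)) / 2 + (f l - f (- l)) / (2 * l) * x).
  assert (Ck : forall x, continuous k x) by (unfold k; cont).
  apply Rle_antisym; apply Rminus_le; fold (k x).
  - apply (second_difference_zero_le l (fun x => f x - k x)); auto; try cont.
    + intros y h H1 H2 H3; rewrite <- (H y h H1 H2 H3); unfold k; ring.
    + unfold k; field; lra.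
    + unfold k; field; lra.
  - apply (second_difference_zero_le l (fun x => k x - f x)); auto; try cont.
    + intros y h H1 H2 H3; rewrite <- (Rmult_0_r (-1)), <- (H y h H1 H2 H3); unfold k; ring.
    + unfold k; field; lra.
    + unfold k; field; lra.
Qed.

Definition green_sum (l m sigma : R) (S : R -> R -> R) (x y : R) : R :=
  green l sigma (fun x => S x y) x + green m sigma (S x) y.

Lemma green_sum_swap l m sigma (S : R -> R -> R) x y :
  green_sum m l sigma (fun y x => S x y) y x = green_sum l m sigma S x y.
Proof. apply Rplus_comm. Qed.

Lemma continuous_green_param m sigma (S : R -> R -> R) y :
  0 < m -> (forall x y, continuity_2d_pt S x y) -> - m <= y <= m ->
  forall x, continuous (fun x => green m sigma (S x) y) x.
Proof.
  intros Hm C Hy x; unfold green.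
  assert (C1 : forall z, - m <= z -> continuous (fun x => RInt (S x) (- m) z) x).
  { intros z Hz; apply (continuous_RInt_param S); auto. }
  assert (C2 : forall z, - m <= z -> continuous (fun x => RInt (fun t => t * S x t) (- m) z) x).
  { intros z Hz; apply (continuous_RInt_param (fun x t => t * S x t)); auto; cont2. }
  assert (B1 := C1 y (proj1 Hy)); assert (B2 := C2 y (proj1 Hy)).
  assert (B3 := C1 m ltac:(lra)); assert (B4 := C2 m ltac:(lra)).
  cont.
Qed.

Lemma green_sum_second_difference l m sigma (S : R -> R -> R) y :
  0 < m -> sigma <> 0 -> 1 - sigma * m <> 0 -> steklov_data l m sigma S ->
  - m <= y <= m -> second_difference_zero l (fun x => green_sum l m sigma S x y).
Proof.
  intros Hm Hs Hsm HS Hy x h Hh H1 H2; unfold green_sum.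
  assert (E := second_difference_green_across l m sigma S x h y Hm Hs Hsm HS Hh H1 H2 Hy).
  assert (E' := second_difference_green_along l sigma (fun x => S x y) x h Hh
    (fun x => continuous_slice_1 S x y (proj1 HS x y))).
  cbv beta in E'; lra.
Qed.

Lemma green_sum_bilinear l m sigma (S : R -> R -> R) :
  0 < l -> 0 < m -> sigma <> 0 -> 1 - sigma * l <> 0 -> 1 - sigma * m <> 0 ->
  steklov_data l m sigma S ->
  exists a0 a1 a2 a3, forall x y, - l <= x <= l -> - m <= y <= m ->
    green_sum l m sigma S x y = a0 + a1 * x + a2 * y + a3 * (x * y).
Proof.
  intros Hl Hm Hs Hsl Hsm HS.
  assert (HS' := steklov_data_swap _ _ _ _ HS).
  assert (Cx : forall y, - m <= y <= m -> forall x, continuous (fun x => green_sum l m sigma S x y) x).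
  { intros y Hy x; apply continuous_Rplus.
    - apply continuous_green; intros; apply continuous_slice_1, HS.
    - apply continuous_green_param; auto; apply HS. }
  assert (Cy : forall x, - l <= x <= l -> forall y, continuous (fun y => green_sum l m sigma S x y) y).
  { intros x Hx y; apply continuous_Rplus.
    - apply (continuous_green_param l sigma (fun y x => S x y)); auto; apply HS'.
    - apply (continuous_green m sigma (S x)); intros.
      apply (continuous_slice_2 S), HS. }
  assert (Ax := fun y Hy => second_difference_zero_affine l _ Hl (Cx y Hy)
         (green_sum_second_difference l m sigma S y Hm Hs Hsm HS Hy)).
  assert (Ay : forall x, - l <= x <= l -> second_difference_zero m (fun y => green_sum l m sigma S x y)).
  { intros x Hx y h H1 H2 H3.
    assert (E := green_sum_second_difference m l sigma
      (fun y x => S x y) x Hl Hs Hsl HS' Hx y h H1 H2 H3).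
    cbv beta in E; rewrite !(green_sum_swap l m sigma S x) in E; exact E. }
  assert (By := fun x Hx => second_difference_zero_affine m _ Hm (Cy x Hx) (Ay x Hx)).
  cbv beta in Ax, By.
  assert (Hll : - l <= l <= l) by lra; assert (Hll' : - l <= - l <= l) by lra.
  pose (h := green_sum l m sigma S).
  (* Being affine in each variable, the function is the bilinear interpolant of its four corner
     values. *)
  exists ((h l m + h l (- m) + h (- l) m + h (- l) (- m)) / 4),
    ((h l m + h l (- m) - h (- l) m - h (- l) (- m)) / (4 * l)),
    ((h l m - h l (- m) + h (- l) m - h (- l) (- m)) / (4 * m)),
    ((h l m - h l (- m) - h (- l) m + h (- l) (- m)) / (4 * l * m)).
  intros x y Hx Hy.
  rewrite (Ax y Hy x Hx), (By l Hll y Hy), (By (- l) Hll' y Hy).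
  fold h; field; lra.
Qed.

(** * Robin difference quotients at the corners *)

(** A discrete form of the outward derivative minus [sigma * u] at the end [e * l], where [e] is 1
    or -1. It makes sense in both variables at once at a corner, where no derivative is available,
    and it is exact on affine functions. *)
Definition robin_quotient (l sigma e d : R) (u : R -> R) : R :=
  (u (e * l) - u (e * (l - d))) / d - sigma * u (e * l).

(** By Taylor's formula and the exact Robin condition, the quotient is [/ d] times the integral of
    [(d - t) * phi (e * (l - t))] over [[0, d]], and the integrand is at most [d * M]. *)
Lemma robin_quotient_green l sigma e d (phi : R -> R) M :
  0 < d < l -> sigma <> 0 -> 1 - sigma * l <> 0 -> e = 1 \/ e = -1 ->
  (forall x, continuous phi x) -> (forall t, - l <= t <= l -> Rabs (phi t) <= M) ->
  Rabs (robin_quotient l sigma e d (green l sigma phi)) <= d * M.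
Proof.
  intros Hd Hs Hsl He C HM.
  assert (D := is_derive_green l sigma phi C).
  assert (D' := is_derive_green' l sigma phi C).
  assert (Rob : e * green' l sigma phi (e * l) = sigma * green l sigma phi (e * l)).
  { destruct He as [-> | ->].
    - rewrite !Rmult_1_l; now apply green_robin_right.
    - replace (-1 * l) with (- l) by ring. rewrite green_robin_left by auto; ring. }
  assert (Hee : e * e = 1) by (destruct He as [-> | ->]; ring).
  assert (Ci : forall t, continuous (fun t => (d - t) * phi (e * (l - t))) t) by cont.
  assert (F : RInt (fun t => (d - t) * phi (e * (l - t))) 0 d
    = green l sigma phi (e * l) - green l sigma phi (e * (l - d))
      - d * (sigma * green l sigma phi (e * l))).
  { rewrite <- Rob.
    rewrite (RInt_ftc (fun t => (d - t) * (e * green' l sigma phi (e * (l - t)))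
      - green l sigma phi (e * (l - t)))).
    - replace (l - 0) with l by ring; eqR; ring.
    - intros t _; specialize (D (e * (l - t))); specialize (D' (e * (l - t))).
      revert D D'; generalize (green l sigma phi) (green' l sigma phi).
      intros f f' D D'; evar_last.
      { auto_derive; [repeat split; eexists; eassumption|reflexivity]. }
      change (l + - t) with (l - t).
      rewrite (Derive_of_is_derive _ _ _ D), (Derive_of_is_derive _ _ _ D').
      transitivity ((d - t) * (e * e * phi (e * (l - t)))); [ring|rewrite Hee; ring].
    - auto. }
  replace (robin_quotient l sigma e d (green l sigma phi))
    with (/ d * RInt (fun t => (d - t) * phi (e * (l - t))) 0 d)
    by (unfold robin_quotient; rewrite F; field; lra).
  rewrite Rabs_mult, Rabs_pos_eq by (left; apply Rinv_0_lt_compat; lra).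
  apply (Rmult_le_reg_l d); [lra|].
  rewrite <- Rmult_assoc, Rinv_r, Rmult_1_l by lra.
  eapply Rle_trans.
  { apply (abs_RInt_le_const _ 0 d (d * M)); [lra|now apply ex_RInt_cont|].
    intros t Ht; rewrite Rabs_mult; apply Rmult_le_compat; try apply Rabs_pos.
    - rewrite Rabs_pos_eq; lra.
    - apply HM; destruct He as [-> | ->]; lra. }
  right; ring.
Qed.

(* Continuity of [S] at the corner is what makes the corner flux vanish. *)
Lemma robin_quotient_corner l m sigma (S : R -> R -> R) e f :
  0 < l -> 0 < m -> sigma <> 0 -> 1 - sigma * l <> 0 ->
  (forall x y, continuity_2d_pt S x y) -> e = 1 \/ e = -1 -> f = 1 \/ f = -1 ->
  forall eps, 0 < eps -> exists d0, 0 < d0 /\ forall d, 0 < d < d0 ->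
  Rabs (robin_quotient m sigma f d (fun y =>
    robin_quotient l sigma e d (green l sigma (fun x => S x y)))) <= eps.
Proof.
  intros Hl Hm Hs Hsl C He Hf eps Heps.
  assert (Cx : forall y, forall x, continuous (fun x => S x y) x)
    by (intros; now apply continuous_slice_1).
  assert (HM : exists M, 0 <= M /\ forall x, - l <= x <= l -> Rabs (S x (f * m)) <= M).
  { destruct (continuity_ab_maj (fun x => Rabs (S x (f * m))) (- l) l) as [X [HX _]].
    - lra.
    - intros x _; apply continuity_pt_filterlim.
      apply (continuous_comp (fun x => S x (f * m)) Rabs); [apply Cx|].
      apply continuity_pt_filterlim, Rcontinuity_abs.
    - exists (Rabs (S X (f * m))); split; [apply Rabs_pos|auto]. }
  destruct HM as [M [HM0 HM]].
  assert (He2 : 0 < eps / 2) by lra.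
  destruct (uniform_continuity_2d S (- l) l (- m) m (fun x y _ _ => C x y)
    (mkposreal _ He2)) as [[d1 Hd1] H1]; simpl in H1.
  pose (K := Rabs sigma * M + 1).
  assert (HK : 0 < K).
  { unfold K; assert (0 <= Rabs sigma * M) by (apply Rmult_le_pos; auto using Rabs_pos). lra. }
  exists (Rmin (Rmin l m) (Rmin d1 (eps / 2 / K))); split.
  { repeat apply Rmin_glb_lt; auto; now apply Rdiv_lt_0_compat. }
  intros d [Hd Hd'].
  assert (Q1 := Rmin_l (Rmin l m) (Rmin d1 (eps / 2 / K))).
  assert (Q2 := Rmin_r (Rmin l m) (Rmin d1 (eps / 2 / K))).
  assert (Q3 := Rmin_l l m); assert (Q4 := Rmin_r l m).
  assert (Q5 := Rmin_l d1 (eps / 2 / K)); assert (Q6 := Rmin_r d1 (eps / 2 / K)).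
  assert (A1 : Rabs (robin_quotient l sigma e d (green l sigma (fun x => S x (f * m)))) <= d * M).
  { apply robin_quotient_green; auto; lra. }
  (* The difference in [y] is moved inside the Green operator, where uniform continuity makes its
     argument smaller than [eps / 2]. The factor [d] gained here cancels the [/ d] of the outer
     quotient; the remaining term is at most [d * K], with [K] kept positive by its [+ 1]. *)
  assert (A2 : Rabs (robin_quotient l sigma e d
    (green l sigma (fun x => S x (f * m) + (-1) * S x (f * (m - d))))) <= d * (eps / 2)).
  { apply robin_quotient_green; auto; [lra|cont|].
    intros t Ht; left; replace (_ + _) with (S t (f * m) - S t (f * (m - d))) by ring.
    apply H1; try lra.
    - destruct Hf as [-> | ->]; lra.
    - destruct Hf as [-> | ->]; lra.
    - rewrite Rminus_eq_0, Rabs_R0; lra.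
    - replace (f * m - f * (m - d)) with (f * d) by ring.
      destruct Hf as [-> | ->]; unfold Rabs; destruct Rcase_abs; lra. }
  unfold robin_quotient at 1.
  replace (robin_quotient l sigma e d (green l sigma (fun x => S x (f * m)))
    - robin_quotient l sigma e d (green l sigma (fun x => S x (f * (m - d)))))
    with (robin_quotient l sigma e d
      (green l sigma (fun x => S x (f * m) + (-1) * S x (f * (m - d))))).
  2: { unfold robin_quotient; rewrite !(green_lin l sigma) by cont; field; lra. }
  unfold Rminus at 1; eapply Rle_trans; [apply Rabs_triang|].
  rewrite Rabs_Ropp, Rabs_mult; unfold Rdiv at 1.
  rewrite Rabs_mult, (Rabs_pos_eq (/ d)) by (left; apply Rinv_0_lt_compat; lra).
  replace eps with (d * (eps / 2) * / d + K * (eps / 2 / K)) by (field; lra).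
  apply Rplus_le_compat.
  - apply Rmult_le_compat_r; [left; apply Rinv_0_lt_compat; lra|exact A2].
  - apply Rle_trans with (Rabs sigma * (d * M)).
    + apply Rmult_le_compat_l; auto using Rabs_pos.
    + apply Rle_trans with (K * d); [unfold K; nra|].
      apply Rmult_le_compat_l; lra.
Qed.

(** The hypothesis is the product of the two Robin expressions applied to the bilinear function at
    the corner [(e * l, f * m)]: in [x] the constant gives [- sigma] and [x] gives
    [e * (1 - sigma * l)]. Signed sums over the four corners isolate each coefficient. *)
Lemma bilinear_zero l m sigma a0 a1 a2 a3 :
  sigma <> 0 -> 1 - sigma * l <> 0 -> 1 - sigma * m <> 0 ->
  (forall e f, e = 1 \/ e = -1 -> f = 1 \/ f = -1 ->
    sigma * sigma * a0 - sigma * e * (1 - sigma * l) * a1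
    - sigma * f * (1 - sigma * m) * a2
    + e * f * (1 - sigma * l) * (1 - sigma * m) * a3 = 0) ->
  a0 = 0 /\ a1 = 0 /\ a2 = 0 /\ a3 = 0.
Proof.
  intros Hs Hl Hm H.
  assert (P := H 1 1 (or_introl eq_refl) (or_introl eq_refl)).
  assert (Q := H 1 (-1) (or_introl eq_refl) (or_intror eq_refl)).
  assert (V := H (-1) 1 (or_intror eq_refl) (or_introl eq_refl)).
  assert (W := H (-1) (-1) (or_intror eq_refl) (or_intror eq_refl)).
  repeat split.
  - apply (Rmult_eq_reg_l (sigma * sigma)); [lra|].
    now apply Rmult_integral_contrapositive_currified.
  - apply (Rmult_eq_reg_l (sigma * (1 - sigma * l))); [lra|].
    now apply Rmult_integral_contrapositive_currified.
  - apply (Rmult_eq_reg_l (sigma * (1 - sigma * m))); [lra|].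
    now apply Rmult_integral_contrapositive_currified.
  - apply (Rmult_eq_reg_l ((1 - sigma * l) * (1 - sigma * m))); [lra|].
    now apply Rmult_integral_contrapositive_currified.
Qed.

Lemma green_sum_zero l m sigma (S : R -> R -> R) :
  0 < l -> 0 < m -> sigma <> 0 -> 1 - sigma * l <> 0 -> 1 - sigma * m <> 0 ->
  steklov_data l m sigma S ->
  forall x y, - l <= x <= l -> - m <= y <= m -> green_sum l m sigma S x y = 0.
Proof.
  intros Hl Hm Hs Hsl Hsm HS.
  destruct (green_sum_bilinear l m sigma S) as (a0 & a1 & a2 & a3 & B); auto.
  destruct (bilinear_zero l m sigma a0 a1 a2 a3) as (-> & -> & -> & ->); auto.
  - intros e f He Hf; apply cond_eq; intros eps Heps; rewrite Rminus_0_r.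
    destruct HS as [C _].
    assert (He3 : 0 < eps / 3) by lra.
    destruct (robin_quotient_corner l m sigma S e f Hl Hm Hs Hsl C He Hf _ He3)
      as (d1 & Hd1 & E1).
    destruct (robin_quotient_corner m l sigma (fun y x => S x y) f e Hm Hl Hs Hsm
      (fun y x => continuity_2d_swap S x y (C x y)) Hf He _ He3) as (d2 & Hd2 & E2).
    pose (d := Rmin (Rmin d1 d2) (Rmin l m) / 2).
    assert (Hd : 0 < d < d1 /\ d < d2 /\ d < l /\ d < m).
    { assert (0 < Rmin (Rmin d1 d2) (Rmin l m)) by (repeat apply Rmin_glb_lt; auto).
      assert (Q1 := Rmin_l (Rmin d1 d2) (Rmin l m)).
      assert (Q2 := Rmin_r (Rmin d1 d2) (Rmin l m)).
      assert (Q3 := Rmin_l l m); assert (Q4 := Rmin_r l m).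
      assert (Q5 := Rmin_l d1 d2); assert (Q6 := Rmin_r d1 d2).
      unfold d; lra. }
    specialize (E1 d ltac:(lra)); specialize (E2 d ltac:(lra)).
    match type of E1 with Rabs ?A <= _ => match type of E2 with Rabs ?B <= _ =>
      apply Rle_lt_trans with (Rabs (A + B)) end end;
      [right; f_equal | eapply Rle_lt_trans; [apply Rabs_triang|lra]].
    assert (Hel : - l <= e * l <= l /\ - l <= e * (l - d) <= l) by (destruct He as [-> | ->]; lra).
    assert (Hfm : - m <= f * m <= m /\ - m <= f * (m - d) <= m) by (destruct Hf as [-> | ->]; lra).
    (* On the bilinear form the double quotient is exact, so its value does not depend on [d]; on
       the two Green terms it splits into the quantities bounded by [E1] and [E2]. *)
    transitivity (robin_quotient m sigma f d (fun y => robin_quotient l sigma e d (fun x =>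
      green_sum l m sigma S x y))).
    + unfold robin_quotient; rewrite !B by lra; field_simplify_eq; [|lra].
      destruct He as [-> | ->]; destruct Hf as [-> | ->]; ring.
    + unfold robin_quotient, green_sum.
      change (fun y => S (e * l) y) with (S (e * l)).
      change (fun y => S (e * (l - d)) y) with (S (e * (l - d))).
      field; lra.
  - intros x y Hx Hy; rewrite B by auto; ring.
Qed.

(** * Positivity and separated modes *)

Lemma is_derive_cosh (x : R) : is_derive cosh x (sinh x).
Proof. apply is_derive_Reals, derivable_pt_lim_cosh. Qed.

Lemma is_derive_sinh (x : R) : is_derive sinh x (cosh x).
Proof. apply is_derive_Reals, derivable_pt_lim_sinh. Qed.

Lemma continuous_cosh (x : R) : continuous cosh x.
Proof. exact (continuous_of_is_derive cosh sinh is_derive_cosh x). Qed.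

Lemma continuous_sinh (x : R) : continuous sinh x.
Proof. exact (continuous_of_is_derive sinh cosh is_derive_sinh x). Qed.

Lemma cosh_pos (x : R) : 0 < cosh x.
Proof. unfold cosh; assert (A := exp_pos x); assert (B := exp_pos (- x)); lra. Qed.

Lemma cosh_opp (x : R) : cosh (- x) = cosh x.
Proof. unfold cosh; rewrite Ropp_involutive; lra. Qed.

Lemma sinh_opp (x : R) : sinh (- x) = - sinh x.
Proof. unfold sinh; rewrite Ropp_involutive; lra. Qed.

Lemma RInt_reflect (g : R -> R) (l : R) :
  (forall x, continuous g x) -> RInt g (- l) l = RInt (fun x => g x + g (- x)) 0 l.
Proof.
  intros C.
  rewrite RInt_Rplus by cont.
  assert (E := RInt_comp_lin (V := R_CompleteNormedModule) g (-1) 0 0 l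
    (ex_RInt_cont _ _ _ C)).
  replace (-1 * 0 + 0) with 0 in E by ring; replace (-1 * l + 0) with (- l) in E by ring.
  rewrite (RInt_ext_all _ (fun x => (-1) * g (- x))) in E.
  - rewrite RInt_Rscal in E by cont.
    assert (Ch : RInt g (- l) 0 + RInt g 0 l = RInt g (- l) l)
      by (apply (RInt_Chasles g); now apply ex_RInt_cont).
    assert (Sw : - RInt g 0 (- l) = RInt g (- l) 0)
      by (apply (opp_RInt_swap g); now apply ex_RInt_cont).
    lra.
  - intros t; unfold scal; simpl; unfold mult; simpl; do 2 f_equal; ring.
Qed.

(** The integral of [(g - c)^2] is nonnegative for [c = RInt g a b / l]. Dividing by [l] instead of
    [b - a] covers intervals shorter than [l], including degenerate ones. *)
Lemma RInt_cauchy_schwarz (g : R -> R) (a b l : R) :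
  (forall x, continuous g x) -> a <= b -> b - a <= l -> 0 < l ->
  (RInt g a b) ^ 2 <= l * RInt (fun x => g x * g x) a b.
Proof.
  intros C Hab Hl Hl0.
  assert (Hdiv : forall u, u = u / l * l) by (intros; field; lra).
  pose (c := RInt g a b / l).
  assert (P : 0 <= RInt (fun x => (g x * g x - (2 * c) * g x) + c * c) a b).
  { apply RInt_ge_0; [lra|apply ex_RInt_cont; cont|].
    intros; replace (_ + _) with ((g x - c) * (g x - c)) by ring; apply Rle_0_sqr. }
  rewrite RInt_Rplus, RInt_Rminus, RInt_Rscal, RInt_const in P by cont.
  unfold scal in P; simpl in P; unfold mult in P; simpl in P.
  assert (Ec : RInt g a b = c * l) by apply Hdiv.
  rewrite Ec in *.
  assert (0 <= c * c) by apply Rle_0_sqr. nra.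
Qed.

(** With [f] the Green solution, integration by parts turns the form into
    [E - sigma * (f l ^ 2 + f (- l) ^ 2)], where [E] is the integral of [f' ^ 2]. For positive
    [sigma] the odd part of [f] vanishes at 0 and the even part at [z], so Cauchy-Schwarz bounds the
    boundary squares by [l * E], leaving at least [(1 - sigma * l) * E]. If the form is zero, [f']
    vanishes and so does [phi]. *)
Lemma green_form_pos l sigma (phi : R -> R) :
  0 < l -> sigma <> 0 -> sigma * l < 1 -> (forall x, continuous phi x) ->
  sigma < 0 \/ (exists z, 0 <= z <= l /\ green l sigma phi z + green l sigma phi (- z) = 0) ->
  0 <= RInt (fun x => phi x * green l sigma phi x) (- l) l /\
  (RInt (fun x => phi x * green l sigma phi x) (- l) l = 0 ->
   forall x, - l <= x <= l -> phi x = 0).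
Proof.
  intros Hl Hs Hsl C Hz.
  assert (D := is_derive_green l sigma phi C).
  assert (D' := is_derive_green' l sigma phi C).
  assert (Cf := continuous_green l sigma phi C).
  assert (Cf' := continuous_green' l sigma phi C).
  assert (Rr := green_robin_right l sigma phi Hs ltac:(lra)).
  assert (Rl := green_robin_left l sigma phi Hs ltac:(lra)).
  revert Hz D D' Cf Cf' Rr Rl.
  generalize (green l sigma phi) (green' l sigma phi); intros f f' Hz D D' Cf Cf' Rr Rl.
  pose (E := RInt (fun x => f' x * f' x) (- l) l).
  assert (EI : RInt (fun x => phi x * f x) (- l) l = E - sigma * (f l ^ 2 + f (- l) ^ 2)).
  { assert (F : RInt (fun x => phi x * f x - f' x * f' x) (- l) l
      = - (f' l * f l) - - (f' (- l) * f (- l))).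
    { rewrite (RInt_ftc (fun x => - (f' x * f x))); [reflexivity| |cont].
      intros t _; specialize (D t); specialize (D' t); evar_last.
      { auto_derive; [repeat split; eexists; eassumption|reflexivity]. }
      rewrite (Derive_of_is_derive _ _ _ D), (Derive_of_is_derive _ _ _ D'); ring. }
    rewrite RInt_Rminus, Rr, Rl in F by cont. unfold E; lra. }
  assert (E0 : 0 <= E).
  { apply RInt_ge_0; [lra|apply ex_RInt_cont; cont|intros; apply Rle_0_sqr]. }
  assert (Key : exists k, 0 < k /\ k * E <= RInt (fun x => phi x * f x) (- l) l).
  { destruct Hz as [Hneg|[z [Hz0 Hz]]].
    - exists 1; split; [lra|]; rewrite EI; nra.
    - destruct (Rlt_dec sigma 0) as [Hneg|Hpos].
      { exists 1; split; [lra|]; rewrite EI; nra. }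
      exists (1 - sigma * l); split; [lra|].
      (* Odd and even parts of [f] are bounded separately, each with half the energy. *)
      pose (ge := fun x => (f' x + f' (- x)) * / 2); pose (go := fun x => (f' x - f' (- x)) * / 2).
      assert (Cge : forall x, continuous ge x) by (unfold ge; cont).
      assert (Cgo : forall x, continuous go x) by (unfold go; cont).
      assert (B1 := RInt_cauchy_schwarz ge 0 l l Cge ltac:(lra) ltac:(lra) Hl).
      assert (B2 := RInt_cauchy_schwarz go z l l Cgo ltac:(lra) ltac:(lra) Hl).
      assert (I1 : RInt ge 0 l = (f l - f (- l)) / 2).
      { rewrite (RInt_ftc (fun x => (f x - f (- x)) / 2)).
        - rewrite Ropp_0; eqR; field.
        - intros t _; assert (D1 := D t); assert (D2 := D (- t)); evar_last.
          { auto_derive; [repeat split; eexists; eassumption|reflexivity]. }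
          rewrite (Derive_of_is_derive _ _ _ D1), (Derive_of_is_derive _ _ _ D2); unfold ge; field.
        - auto. }
      assert (I2 : RInt go z l = (f l + f (- l)) / 2).
      { rewrite (RInt_ftc (fun x => (f x + f (- x)) / 2)).
        - rewrite Hz; eqR; field.
        - intros t _; assert (D1 := D t); assert (D2 := D (- t)); evar_last.
          { auto_derive; [repeat split; eexists; eassumption|reflexivity]. }
          rewrite (Derive_of_is_derive _ _ _ D1), (Derive_of_is_derive _ _ _ D2); unfold go; field.
        - auto. }
      assert (I3 : E = 2 * (RInt (fun x => ge x * ge x) 0 l + RInt (fun x => go x * go x) 0 l)).
      { unfold E; rewrite RInt_reflect, <- RInt_Rplus, <- RInt_Rscal by cont.
        apply RInt_ext_all; intros; unfold ge, go; field. }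
      assert (I4 : RInt (fun x => go x * go x) z l <= RInt (fun x => go x * go x) 0 l).
      { rewrite <- (RInt_Chasles (fun x => go x * go x) 0 z l) by (apply ex_RInt_cont; cont).
        assert (0 <= RInt (fun x => go x * go x) 0 z).
        { apply RInt_ge_0; [lra|apply ex_RInt_cont; cont|intros; apply Rle_0_sqr]. }
        unfold plus; simpl; lra. }
      assert (B3 : f l ^ 2 + f (- l) ^ 2 <= l * E).
      { rewrite I1 in B1; rewrite I2 in B2; rewrite I3; nra. }
      rewrite EI. nra. }
  destruct Key as [k [Hk Key]]; split.
  - eapply Rle_trans; [|exact Key]; apply Rmult_le_pos; lra.
  - intros Z; rewrite Z in Key.
    assert (EZ : E = 0) by nra.
    assert (Z' : forall x, - l <= x <= l -> f' x = 0).
    { intros x Hx; apply Rsqr_0_uniq.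
      apply (RInt_nonneg_zero (fun x => f' x * f' x) (- l) l); auto; [lra|cont|].
      intros; apply Rle_0_sqr. }
    intros x Hx; apply Ropp_eq_0_compat in EZ.
    assert (Q := derive_constant_zero f' (fun x => - phi x) (- l) l 0 ltac:(lra) D'
      ltac:(cont) Z' x Hx). cbv beta in Q; lra.
Qed.

(** Only the even part of [f] contributes to the integral; the mean value theorem for a primitive
    gives a point where the even part times [w] is zero. *)
Lemma even_part_zero (f w : R -> R) (l : R) :
  0 < l -> (forall x, continuous f x) -> (forall x, continuous w x) ->
  (forall x, w (- x) = w x) -> (forall x, 0 < w x) ->
  RInt (fun x => f x * w x) (- l) l = 0 ->
  exists z, 0 <= z <= l /\ f z + f (- z) = 0.
Proof.
  intros Hl Cf Cw He Hw H.
  rewrite RInt_reflect in H by cont.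
  pose (g := fun x => f x * w x + f (- x) * w (- x)).
  assert (Cg : forall x, continuous g x) by (unfold g; cont).
  destruct (MVT_gen (fun x => RInt g 0 x) 0 l g) as [z [Hz E]].
  - intros; now apply is_derive_primitive.
  - intros x _; apply continuity_pt_filterlim.
    apply (continuous_of_is_derive (fun x => RInt g 0 x) g); intros.
    now apply is_derive_primitive.
  - rewrite Rmin_left, Rmax_right in Hz by lra.
    exists z; split; [exact Hz|].
    fold g in H; rewrite H, RInt_point in E.
    apply (Rmult_eq_reg_r (w z * l)).
    + unfold g in E; rewrite He in E; unfold zero in E; simpl in E; lra.
    + assert (0 < w z) by auto; apply Rgt_not_eq; nra.
Qed.

(* [cosh (r x)] is the eigenfunction of the Robin problem with negative eigenvalue. *)
Definition robin_root (l sigma r : R) : Prop :=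
  0 < r /\ r * sinh (r * l) = sigma * cosh (r * l).

Lemma continuous_cosh_scal (r x : R) : continuous (fun x => cosh (r * x)) x.
Proof. apply (continuous_Rcomp cosh (fun x => r * x)); [cont|apply continuous_cosh]. Qed.

Lemma green_cosh l sigma r :
  0 < l -> sigma <> 0 -> 1 - sigma * l <> 0 -> robin_root l sigma r ->
  forall x, - l <= x <= l ->
  green l sigma (fun t => cosh (r * t)) x = - (/ (r * r) * cosh (r * x)).
Proof.
  intros Hl Hs Hsl [Hr E] x Hx; symmetry.
  apply (green_unique l sigma (fun t => cosh (r * t))
    (fun x => - (/ (r * r) * cosh (r * x))) (fun x => - (/ r * sinh (r * x)))); auto.
  - apply continuous_cosh_scal.
  - intros t; assert (C := continuous_cosh_scal r t); cont.
  - assert (C := continuous_sinh); cont.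
  - assert (C := continuous_sinh); cont.
  - intros t _; evar_last; [auto_derive; [exact I|reflexivity]|field; lra].
  - intros t _; evar_last; [auto_derive; [exact I|reflexivity]|field; lra].
  - replace (- (/ r * sinh (r * l))) with (- / (r * r) * (r * sinh (r * l))) by (field; lra).
    rewrite E; ring.
  - replace (r * - l) with (- (r * l)) by ring; rewrite cosh_opp, sinh_opp.
    replace (- (/ r * - sinh (r * l))) with (/ (r * r) * (r * sinh (r * l))) by (field; lra).
    rewrite E; ring.
Qed.

(** By symmetry of the Green operator, orthogonality to its eigenfunction [cosh (p * x)] passes from
    [phi] to the Green solution, whose even part must then vanish somewhere. *)
Lemma green_form_pos_orth l sigma (phi : R -> R) :
  0 < l -> sigma <> 0 -> sigma * l < 1 -> (forall x, continuous phi x) ->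
  sigma < 0 \/ (exists p, robin_root l sigma p /\
                RInt (fun x => phi x * cosh (p * x)) (- l) l = 0) ->
  0 <= RInt (fun x => phi x * green l sigma phi x) (- l) l /\
  (RInt (fun x => phi x * green l sigma phi x) (- l) l = 0 ->
   forall x, - l <= x <= l -> phi x = 0).
Proof.
  intros Hl Hs Hsl C H; apply green_form_pos; auto.
  destruct H as [H|[p [Hp H]]]; [now left|right].
  assert (Cc := continuous_cosh_scal p).
  apply (even_part_zero _ (fun x => cosh (p * x))); auto.
  - now apply continuous_green.
  - intros x; rewrite <- cosh_opp; f_equal; ring.
  - intros; apply cosh_pos.
  - rewrite (green_sym l sigma phi (fun x => cosh (p * x))) by (auto; lra).
    rewrite (RInt_ext_le _ (fun x => (- / (p * p)) * (phi x * cosh (p * x)))); [|lra|].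
    + rewrite RInt_Rscal, H by cont; eqR; ring.
    + intros t Ht; rewrite green_cosh by (auto; lra); ring.
Qed.

(** * The integral equation and its modes *)

(** The derivative-free form of the Steklov problem, for [sigma] different from 0, [/ l] and [/ m].
    It is linear in [S], which allows a multiple of the eigenfunction to be subtracted. *)
Definition green_null (l m sigma : R) (S : R -> R -> R) : Prop :=
  (forall x y, continuity_2d_pt S x y) /\
  forall x y, - l <= x <= l -> - m <= y <= m -> green_sum l m sigma S x y = 0.

Lemma green_null_swap l m sigma (S : R -> R -> R) :
  green_null l m sigma S -> green_null m l sigma (fun y x => S x y).
Proof.
  intros [C H]; split.
  - intros; now apply continuity_2d_swap.
  - intros x y Hx Hy; rewrite (green_sum_swap l m sigma S); auto.
Qed.

Lemma continuity_2d_green l sigma (S : R -> R -> R) :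
  (forall x y, continuity_2d_pt S x y) ->
  forall x y, continuity_2d_pt (fun x y => green l sigma (fun t => S t y) x) x y.
Proof.
  intros C x y; unfold green.
  assert (C0 := continuity_2d_primitive S (- l) C).
  assert (C1 := continuity_2d_primitive (fun t y => t * S t y) (- l) ltac:(cont2)).
  assert (C2 := continuous_slice_2 _ l y (C0 l y)).
  assert (C3 := continuous_slice_2 _ l y (C1 l y)).
  cbv beta in C2, C3; cont2.
Qed.

Lemma green_null_zero l m sigma (S : R -> R -> R) :
  0 < l -> 0 < m -> sigma <> 0 -> sigma * l < 1 -> sigma * m < 1 ->
  green_null l m sigma S ->
  sigma < 0 \/
  (exists p, robin_root l sigma p /\ forall y, - m <= y <= m ->
     RInt (fun x => S x y * cosh (p * x)) (- l) l = 0) /\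
  (exists r, robin_root m sigma r /\ forall x, - l <= x <= l ->
     RInt (fun y => S x y * cosh (r * y)) (- m) m = 0) ->
  forall x y, - l <= x <= l -> - m <= y <= m -> S x y = 0.
Proof.
  intros Hl Hm Hs Hsl Hsm [C H0] Horth.
  assert (C' : forall x y, continuity_2d_pt (fun y x => S x y) x y)
    by (intros; now apply continuity_2d_swap).
  assert (CG := continuity_2d_green l sigma S C).
  assert (CG' := continuity_2d_green m sigma (fun y x => S x y) C').
  cbv beta in CG'.
  pose (J := fun y => RInt (fun x => S x y * green l sigma (fun t => S t y) x) (- l) l).
  pose (K := fun x => RInt (fun y => S x y * green m sigma (S x) y) (- m) m).
  assert (PJ : forall y, - m <= y <= m ->
    0 <= J y /\ (J y = 0 -> forall x, - l <= x <= l -> S x y = 0)).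
  { intros y Hy; apply (green_form_pos_orth l sigma (fun x => S x y)); auto.
    - intros; now apply continuous_slice_1.
    - destruct Horth as [?|[[p [Hp Ep]] _]]; [now left|right; exists p; auto]. }
  assert (PK : forall x, - l <= x <= l -> 0 <= K x).
  { intros x Hx; apply (green_form_pos_orth m sigma (S x)); auto.
    - intros; now apply (continuous_slice_2 S).
    - destruct Horth as [?|[_ [r [Hr Er]]]]; [now left|right; exists r; auto]. }
  assert (CJ : forall y, continuous J y).
  { intros y.
    apply (continuous_RInt_param (fun y x => S x y * green l sigma (fun t => S t y) x)); [lra|].
    intros u t _; apply continuity_2d_pt_mult; [apply C'|].
    now apply (continuity_2d_swap (fun x y => green l sigma (fun t => S t y) x)). }
  assert (CK : forall x, continuous K x).
  { intros x.
    apply (continuous_RInt_param (fun x y => S x y * green m sigma (S x) y)); [lra|].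
    intros u t _; apply continuity_2d_pt_mult; [apply C|].
    now apply (continuity_2d_swap (fun y x => green m sigma (S x) y)). }
  assert (E : RInt J (- m) m = (-1) * RInt K (- l) l).
  { unfold J; rewrite (RInt_swap_order (fun y x => S x y * green l sigma (fun t => S t y) x)); [|lra|lra|].
    - rewrite <- RInt_Rscal by auto.
      apply RInt_ext_le; [lra|]; intros x Hx.
      unfold K; rewrite <- RInt_Rscal.
      + apply RInt_ext_le; [lra|]; intros y Hy.
        assert (Q := H0 x y Hx Hy); unfold green_sum in Q.
        replace (green l sigma (fun t => S t y) x) with (- green m sigma (S x) y) by lra; ring.
      + intros y; apply continuous_Rmult; [now apply continuous_slice_2|].
        apply (continuous_slice_1 (fun y x => green m sigma (S x) y)), CG'.
    - intros y x; apply continuity_2d_pt_mult; [apply C'|].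
      now apply (continuity_2d_swap (fun x y => green l sigma (fun t => S t y) x)). }
  assert (0 <= RInt J (- m) m).
  { apply RInt_ge_0; [lra|now apply ex_RInt_cont|intros; apply PJ; lra]. }
  assert (0 <= RInt K (- l) l).
  { apply RInt_ge_0; [lra|now apply ex_RInt_cont|intros; apply PK; lra]. }
  intros x y Hx Hy; apply (PJ y Hy); auto.
  apply (RInt_nonneg_zero J (- m) m); auto; try lra.
  intros; now apply PJ.
Qed.

Lemma RInt_green_param l m sigma (S : R -> R -> R) (w : R -> R) x :
  0 < l -> 0 < m -> - l <= x <= l ->
  (forall x y, continuity_2d_pt S x y) -> (forall y, continuous w y) ->
  RInt (fun y => green l sigma (fun t => S t y) x * w y) (- m) m
  = green l sigma (fun x => RInt (fun y => S x y * w y) (- m) m) x.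
Proof.
  intros Hl Hm Hx C Cw; unfold green.
  assert (Sw : forall k : R -> R -> R, (forall x y, continuity_2d_pt k x y) ->
    forall z, - l <= z ->
    RInt (fun y => RInt (fun t => k t y) (- l) z * w y) (- m) m
    = RInt (fun t => RInt (fun y => k t y * w y) (- m) m) (- l) z).
  { intros k Ck z Hz.
    rewrite <- (RInt_swap_order (fun y t => k t y * w y)); [|lra|lra|].
    - apply RInt_ext_all; intros y.
      rewrite (RInt_ext_all (fun t => k t y * w y) (fun t => w y * k t y)) by (intros; ring).
      rewrite RInt_Rscal by (intros; now apply continuous_slice_1); apply Rmult_comm.
    - intros; apply continuity_2d_pt_mult; [now apply continuity_2d_swap|].
      now apply (continuity_2d_fst w). }
  assert (C1 : forall x y, continuity_2d_pt (fun t y => t * S t y) x y) by cont2.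
  assert (Sw1 : forall z, - l <= z ->
    RInt (fun y => RInt (fun t => t * S t y) (- l) z * w y) (- m) m
    = RInt (fun t => t * RInt (fun y => S t y * w y) (- m) m) (- l) z).
  { intros z Hz; rewrite (Sw (fun t y => t * S t y) C1 z Hz).
    apply RInt_ext_all; intros t; rewrite <- RInt_Rscal.
    - apply RInt_ext_all; intros; ring.
    - intros; apply continuous_Rmult; [now apply continuous_slice_2|auto]. }
  rewrite <- (Sw S C x), <- (Sw S C l), <- (Sw1 x), <- (Sw1 l) by lra.
  assert (Ci : forall (k : R -> R -> R), (forall x y, continuity_2d_pt k x y) ->
    forall z, - l <= z -> forall y, continuous (fun y => RInt (fun t => k t y) (- l) z * w y) y).
  { intros k Ck z Hz y; apply continuous_Rmult; [|auto].
    apply (continuous_RInt_param (fun y t => k t y)); auto.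
    intros; now apply continuity_2d_swap. }
  assert (K1 := Ci S C x ltac:(lra)); assert (K2 := Ci S C l ltac:(lra)).
  assert (K3 := Ci _ C1 x ltac:(lra)); assert (K4 := Ci _ C1 l ltac:(lra)).
  cbv beta in K1, K2, K3, K4.
  assert (L : forall (f1 f2 f3 f4 : R -> R) (c1 c2 c3 : R),
    (forall y, continuous f1 y) -> (forall y, continuous f2 y) ->
    (forall y, continuous f3 y) -> (forall y, continuous f4 y) ->
    RInt (fun y => f1 y - c1 * f2 y + c2 * f3 y + c3 * f4 y) (- m) m
    = RInt f1 (- m) m - c1 * RInt f2 (- m) m + c2 * RInt f3 (- m) m + c3 * RInt f4 (- m) m).
  { intros; rewrite !RInt_Rplus, RInt_Rminus, !RInt_Rscal by cont; reflexivity. }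
  rewrite <- (L _ _ _ _ _ _ _ K3 K1 K2 K4).
  apply RInt_ext_all; intros; ring.
Qed.

(** With [c = cosh (r * y)], the equation and symmetry give [<T_l s, c> = - <T_m s, c> = - <s, T_m
    c> = <s, c> / r^2], and [T_l] commutes with the pairing in [y]. *)
Lemma green_mode l m sigma r (S : R -> R -> R) :
  0 < l -> 0 < m -> sigma <> 0 -> 1 - sigma * m <> 0 ->
  green_null l m sigma S -> robin_root m sigma r ->
  forall x, - l <= x <= l ->
  RInt (fun y => S x y * cosh (r * y)) (- m) m
  = r * r * green l sigma (fun x => RInt (fun y => S x y * cosh (r * y)) (- m) m) x.
Proof.
  intros Hl Hm Hs Hsm [C H0] Hr x Hx.
  assert (Cc := continuous_cosh_scal r).
  assert (Cx : forall y, continuous (S x) y) by (intros; now apply (continuous_slice_2 S)).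
  rewrite <- (RInt_green_param l m sigma S (fun y => cosh (r * y)) x) by auto.
  rewrite (RInt_ext_le (fun y => green l sigma (fun t => S t y) x * cosh (r * y))
    (fun y => (-1) * (green m sigma (S x) y * cosh (r * y)))); [|lra|].
  - rewrite RInt_Rscal
      by (intros; apply continuous_Rmult; [now apply continuous_green|apply Cc]).
    rewrite (green_sym m sigma (S x) (fun y => cosh (r * y))) by auto.
    rewrite (RInt_ext_le (fun y => S x y * green m sigma (fun y => cosh (r * y)) y)
      (fun y => (- / (r * r)) * (S x y * cosh (r * y)))); [|lra|].
    + rewrite RInt_Rscal by cont.
      assert (Q : forall d, d = r * r * (-1 * (- / (r * r) * d)))
        by (intros; destruct Hr; field; lra).
      apply Q.
    + intros t Ht; rewrite green_cosh by auto; ring.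
  - intros y Hy; assert (Q := H0 x y Hx Hy); unfold green_sum in Q.
    replace (green l sigma (fun t => S t y) x) with (- green m sigma (S x) y) by lra; ring.
Qed.

(** The Green solution satisfies [f'' = - r^2 f]. The interval being symmetric, the sum and the
    difference of the two Robin conditions decouple the sine and cosine amplitudes. *)
Lemma green_eigen_trig l sigma r (phi : R -> R) :
  0 < l -> 0 < r -> sigma <> 0 -> 1 - sigma * l <> 0 -> (forall x, continuous phi x) ->
  (forall x, - l <= x <= l -> phi x = r * r * green l sigma phi x) ->
  exists A B, A * (r * sin (r * l) + sigma * cos (r * l)) = 0 /\
    B * (r * cos (r * l) - sigma * sin (r * l)) = 0 /\
    forall x, - l <= x <= l -> phi x = A * cos (r * x) + B * sin (r * x).
Proof.
  intros Hl Hr Hs Hsl C Hphi.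
  assert (D := is_derive_green l sigma phi C).
  assert (D' := is_derive_green' l sigma phi C).
  assert (Rr := green_robin_right l sigma phi Hs ltac:(lra)).
  assert (Rl := green_robin_left l sigma phi Hs ltac:(lra)).
  revert Hphi D D' Rr Rl.
  generalize (green l sigma phi) (green' l sigma phi); intros f f' Hphi D D' Rr Rl.
  (* [al] and [be] are the cosine and sine amplitudes, obtained by rotating [(f, f' / r)] by the
     angle [r * x]; the equation makes them constant. *)
  pose (al := fun x => f x * cos (r * x) - f' x * sin (r * x) / r).
  pose (be := fun x => f x * sin (r * x) + f' x * cos (r * x) / r).
  assert (Hal : forall x, - l <= x <= l -> al x = al (- l)).
  { intros x Hx; destruct (Req_dec x (- l)) as [->|]; [reflexivity|].
    symmetry; apply (eq_is_derive (V := R_NormedModule)); [|lra].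
    intros t Ht; assert (D1 := D t); assert (D2 := D' t); evar_last.
    { unfold al; auto_derive; [repeat split; eexists; eassumption|reflexivity]. }
    rewrite (Derive_of_is_derive _ _ _ D1), (Derive_of_is_derive _ _ _ D2), (Hphi t) by lra.
    change (@zero R_NormedModule) with 0; field; lra. }
  assert (Hbe : forall x, - l <= x <= l -> be x = be (- l)).
  { intros x Hx; destruct (Req_dec x (- l)) as [->|]; [reflexivity|].
    symmetry; apply (eq_is_derive (V := R_NormedModule)); [|lra].
    intros t Ht; assert (D1 := D t); assert (D2 := D' t); evar_last.
    { unfold be; auto_derive; [repeat split; eexists; eassumption|reflexivity]. }
    rewrite (Derive_of_is_derive _ _ _ D1), (Derive_of_is_derive _ _ _ D2), (Hphi t) by lra.
    change (@zero R_NormedModule) with 0; field; lra. }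
  assert (SC : forall x, sin (r * x) * sin (r * x) = 1 - cos (r * x) * cos (r * x)).
  { intros x; assert (Q := sin2_cos2 (r * x)); unfold Rsqr in Q; lra. }
  assert (Ef : forall x, - l <= x <= l -> f x = al (- l) * cos (r * x) + be (- l) * sin (r * x)).
  { intros x Hx; rewrite <- (Hal x Hx), <- (Hbe x Hx); unfold al, be.
    field_simplify_eq; [|lra]; ring_simplify.
    replace (sin (r * x) ^ 2) with (1 - cos (r * x) * cos (r * x)) by (rewrite <- SC; ring).
    ring. }
  assert (Ef' : forall x, - l <= x <= l ->
    f' x = r * (be (- l) * cos (r * x) - al (- l) * sin (r * x))).
  { intros x Hx; rewrite <- (Hal x Hx), <- (Hbe x Hx); unfold al, be.
    field_simplify_eq; [|lra]; ring_simplify.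
    replace (sin (r * x) ^ 2) with (1 - cos (r * x) * cos (r * x)) by (rewrite <- SC; ring).
    ring. }
  rewrite (Ef l), (Ef' l) in Rr by lra.
  rewrite (Ef (- l)), (Ef' (- l)) in Rl by lra.
  replace (r * - l) with (- (r * l)) in Rl by ring; rewrite sin_neg, cos_neg in Rl.
  exists (r * r * al (- l)), (r * r * be (- l)); repeat split.
  - nra.
  - nra.
  - intros x Hx; rewrite Hphi, Ef by auto; ring.
Qed.

Lemma green_null_mode_trig l m sigma r (S : R -> R -> R) :
  0 < l -> 0 < m -> sigma <> 0 -> 1 - sigma * l <> 0 -> 1 - sigma * m <> 0 ->
  green_null l m sigma S -> robin_root m sigma r ->
  exists A B, A * (r * sin (r * l) + sigma * cos (r * l)) = 0 /\
    B * (r * cos (r * l) - sigma * sin (r * l)) = 0 /\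
    forall x, - l <= x <= l ->
    RInt (fun y => S x y * cosh (r * y)) (- m) m = A * cos (r * x) + B * sin (r * x).
Proof.
  intros Hl Hm Hs Hsl Hsm H Hr.
  apply (green_eigen_trig l sigma r (fun x => RInt (fun y => S x y * cosh (r * y)) (- m) m)); auto.
  - apply Hr.
  - intros x; apply (continuous_RInt_param (fun x y => S x y * cosh (r * y))); [lra|].
    intros u t _; apply continuity_2d_pt_mult; [apply H|].
    apply (continuity_2d_snd (fun y => cosh (r * y))), continuous_cosh_scal.
  - now apply green_mode.
Qed.

(** * Eigenfunctions as strip data *)

(** Composing with this retraction extends an eigenfunction continuously to the whole plane without
    changing it on the rectangle. *)
Definition clamp (l x : R) : R := Rmax (- l) (Rmin l x).

Lemma clamp_id l x : - l <= x <= l -> clamp l x = x.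
Proof. intros H; unfold clamp; rewrite Rmin_right, Rmax_right; lra. Qed.

Lemma clamp_bound l x : 0 < l -> - l <= clamp l x <= l.
Proof.
  intros H; unfold clamp, Rmax, Rmin; repeat destruct Rle_dec; lra.
Qed.

Lemma clamp_lipschitz l x y : 0 < l -> Rabs (clamp l x - clamp l y) <= Rabs (x - y).
Proof.
  intros H; unfold clamp, Rmax, Rmin, Rabs.
  repeat destruct Rle_dec; repeat destruct Rcase_abs; lra.
Qed.

Lemma continuity_2d_clamp a (s : R -> R -> R) :
  0 < a -> continuous_on (rect a) (fun p : R * R => s (fst p) (snd p)) ->
  forall x y, continuity_2d_pt (fun x y => s (clamp 1 x) (clamp a y)) x y.
Proof.
  intros Ha H x y eps.
  assert (B1 := clamp_bound 1 x Rlt_0_1); assert (B2 := clamp_bound a y Ha).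
  specialize (H (clamp 1 x, clamp a y) (conj B1 B2)).
  destruct (proj1 (filterlim_locally _ _) H eps) as [d Hd].
  exists d; intros u v Hu Hv.
  apply (Hd (clamp 1 u, clamp a v)).
  - split; (eapply Rle_lt_trans; [apply clamp_lipschitz; lra|assumption]).
  - split; apply clamp_bound; lra.
Qed.

Lemma common_radius d1 d2 d3 d4 :
  0 < d1 -> 0 < d2 -> 0 < d3 -> 0 < d4 ->
  exists d : posreal, d <= d1 /\ d <= d2 /\ d <= d3 /\ d <= d4.
Proof.
  intros H1 H2 H3 H4.
  assert (Hd : 0 < Rmin (Rmin d1 d2) (Rmin d3 d4)) by (repeat apply Rmin_glb_lt; auto).
  exists (mkposreal _ Hd); simpl.
  assert (Q1 := Rmin_l (Rmin d1 d2) (Rmin d3 d4)).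
  assert (Q2 := Rmin_r (Rmin d1 d2) (Rmin d3 d4)).
  assert (Q3 := Rmin_l d1 d2); assert (Q4 := Rmin_r d1 d2).
  assert (Q5 := Rmin_l d3 d4); assert (Q6 := Rmin_r d3 d4); lra.
Qed.

(** [V] continues [V0] beyond each side by the Robin value there; its continuity across the sides is
    exactly the limit of the normal derivative. *)
Lemma steklov_strip_intro l m sigma (S V0 Vy : R -> R -> R) :
  0 < l -> 0 < m -> (forall x y, continuity_2d_pt S x y) ->
  (forall x y, - l < x < l -> - m < y < m ->
     is_derive (fun z => S x z) y (V0 x y) /\ is_derive (fun z => V0 x z) y (Vy x y) /\
     continuity_2d_pt V0 x y /\ continuity_2d_pt Vy x y) ->
  (forall x, - l < x < l -> forall eps, 0 < eps -> exists d, 0 < d /\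
     forall u v, - l < u < l -> - m < v < m -> Rabs (u - x) < d -> Rabs (v - m) < d ->
     Rabs (V0 u v - sigma * S x m) < eps) ->
  (forall x, - l < x < l -> forall eps, 0 < eps -> exists d, 0 < d /\
     forall u v, - l < u < l -> - m < v < m -> Rabs (u - x) < d -> Rabs (v - - m) < d ->
     Rabs (V0 u v - - (sigma * S x (- m))) < eps) ->
  exists V, steklov_strip l m sigma S V Vy.
Proof.
  intros Hl Hm C D Lp Lm.
  pose (V := fun x y => if Rle_dec m y then sigma * S x m
                        else if Rle_dec y (- m) then - (sigma * S x (- m)) else V0 x y).
  assert (Vtop : forall x y, m <= y -> V x y = sigma * S x m).
  { intros x y H; unfold V; destruct Rle_dec; [reflexivity|lra]. }
  assert (Vbot : forall x y, y <= - m -> V x y = - (sigma * S x (- m))).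
  { intros x y H; unfold V; destruct Rle_dec; [lra|]; destruct Rle_dec; [reflexivity|lra]. }
  assert (Vin : forall x y, - m < y < m -> V x y = V0 x y).
  { intros x y H; unfold V; destruct Rle_dec; [lra|]; destruct Rle_dec; [lra|reflexivity]. }
  assert (Ct : forall x y, continuity_2d_pt (fun x _ => sigma * S x m) x y).
  { intros x y; apply (continuity_2d_fst (fun x => sigma * S x m)).
    apply continuous_Rmult; [apply continuous_const|now apply continuous_slice_1]. }
  assert (Cb : forall x y, continuity_2d_pt (fun x _ => - (sigma * S x (- m))) x y).
  { intros x y; apply (continuity_2d_fst (fun x => - (sigma * S x (- m)))).
    apply continuous_Ropp, continuous_Rmult; [apply continuous_const|now apply continuous_slice_1]. }
  exists V; split; [|split].
  - intros x y Hx.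
    destruct (Rlt_dec m y) as [H1|H1]; [|destruct (Rlt_dec y (- m)) as [H2|H2]].
    + apply continuity_2d_pt_ext_loc with (fun x _ => sigma * S x m); [|apply Ct].
      exists (mkposreal (y - m) ltac:(lra)); simpl; intros u v _ Hv.
      apply Rabs_def2 in Hv; symmetry; apply Vtop; lra.
    + apply continuity_2d_pt_ext_loc with (fun x _ => - (sigma * S x (- m))); [|apply Cb].
      exists (mkposreal (- m - y) ltac:(lra)); simpl; intros u v _ Hv.
      apply Rabs_def2 in Hv; symmetry; apply Vbot; lra.
    + destruct (Req_dec y m) as [->|H3]; [|destruct (Req_dec y (- m)) as [->|H4]].
      * intros [e He].
        destruct (Lp x Hx e He) as [d1 [Hd1 E1]].
        destruct (Ct x m (mkposreal e He)) as [[d2 Hd2] E2]; simpl in E2.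
        destruct (common_radius d1 d2 m (Rmin (l - x) (x + l))) as (d & B1 & B2 & B3 & B4);
          auto; [apply Rmin_glb_lt; lra|].
        assert (Q1 := Rmin_l (l - x) (x + l)); assert (Q2 := Rmin_r (l - x) (x + l)).
        exists d; simpl; intros u v Hu Hv.
        assert (Hu' := Rabs_def2 _ _ Hu); assert (Hv' := Rabs_def2 _ _ Hv).
        rewrite (Vtop x m) by lra.
        destruct (Rle_dec m v).
        -- rewrite Vtop by lra; apply (E2 u v); lra.
        -- rewrite Vin by lra; apply E1; lra.
      * intros [e He].
        destruct (Lm x Hx e He) as [d1 [Hd1 E1]].
        destruct (Cb x (- m) (mkposreal e He)) as [[d2 Hd2] E2]; simpl in E2.
        destruct (common_radius d1 d2 m (Rmin (l - x) (x + l))) as (d & B1 & B2 & B3 & B4);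
          auto; [apply Rmin_glb_lt; lra|].
        assert (Q1 := Rmin_l (l - x) (x + l)); assert (Q2 := Rmin_r (l - x) (x + l)).
        exists d; simpl; intros u v Hu Hv.
        assert (Hu' := Rabs_def2 _ _ Hu); assert (Hv' := Rabs_def2 _ _ Hv).
        rewrite (Vbot x (- m)) by lra.
        destruct (Rle_dec v (- m)).
        -- rewrite Vbot by lra; apply (E2 u v); lra.
        -- rewrite Vin by lra; apply E1; lra.
      * apply continuity_2d_pt_ext_loc with V0; [|apply D; lra].
        destruct (common_radius (m - y) (m + y) 1 1) as (d & B1 & B2 & _ & _); try lra.
        exists d; intros u v _ Hv; apply Rabs_def2 in Hv; symmetry; apply Vin; lra.
  - intros x y Hx Hy; destruct (D x y Hx Hy) as (D1 & D2 & _ & C2).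
    rewrite Vin by auto; split; [exact D1|split; [|exact C2]].
    apply is_derive_ext_loc with (fun z => V0 x z); [|exact D2].
    destruct (common_radius (m - y) (m + y) 1 1) as (d & B1 & B2 & _ & _); try lra.
    exists d; intros z Hz; symmetry; apply Vin.
    apply Rabs_def2 in Hz; change (minus z y) with (z - y) in Hz; lra.
  - intros x Hx; split; [apply Vtop|apply Vbot]; lra.
Qed.

Lemma normal_derivative_bound a (u : R -> R -> R) p n lim eps :
  is_normal_derivative a u p n lim -> 0 < eps -> exists d, 0 < d /\
  forall x y, open_rect a (x, y) -> Rabs (x - fst p) < d -> Rabs (y - snd p) < d ->
  Rabs (fst n * Derive (fun z => u z y) x + snd n * Derive (fun z => u x z) y - lim) < eps.
Proof.
  intros H He; destruct p as [p1 p2].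
  destruct (proj1 (filterlim_locally _ _) H (mkposreal eps He)) as [[d Hd] B].
  exists d; split; [exact Hd|]; intros x y Hxy Hx Hy.
  exact (B (x, y) (conj Hx Hy) Hxy).
Qed.

Lemma steklov_eigenspace_data a sigma (s : R -> R -> R) :
  0 < a -> steklov_eigenspace a sigma s ->
  exists S, steklov_data 1 a sigma S /\ forall x y, rect a (x, y) -> S x y = s x y.
Proof.
  intros Ha (Cs & Hint & Hx & Hy).
  pose (S := fun x y => s (clamp 1 x) (clamp a y)).
  assert (C : forall x y, continuity_2d_pt S x y) by now apply continuity_2d_clamp.
  assert (ES : forall x y, -1 <= x <= 1 -> - a <= y <= a -> S x y = s x y).
  { intros x y H1 H2; unfold S; rewrite !clamp_id by lra; reflexivity. }
  pose (sx := fun y x => Derive (fun z => s z y) x).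
  pose (sy := fun x y => Derive (fun z => s x z) y).
  pose (sxx := fun y x => Derive (fun z => sx y z) x).
  pose (syy := fun x y => Derive (fun z => sy x z) y).
  assert (D2 : forall x y, - (1) < x < 1 -> - a < y < a ->
    is_derive (fun z => S x z) y (sy x y) /\ is_derive (fun z => sy x z) y (syy x y) /\
    continuity_2d_pt sy x y /\ continuity_2d_pt syy x y).
  { intros x y H1 H2.
    (* [ex_diff_n] unfolds to a binary tree of differentiations; the pattern follows the branch with
       two derivatives in [y]. *)
    destruct (Hint x y ltac:(split; simpl; lra)) as [(_ & _ & E1 & _ & (C1 & _ & E2 & _ & (C2 & _))) _].
    split; [|split; [now apply Derive_correct|split; [exact C1|exact C2]]].
    apply is_derive_ext_loc with (fun z => s x z); [|now apply Derive_correct].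
    destruct (common_radius (a - y) (a + y) 1 1) as (d & B1 & B2 & _ & _); try lra.
    exists d; intros z Hz; symmetry; apply ES; [lra|].
    apply Rabs_def2 in Hz; change (minus z y) with (z - y) in Hz; lra. }
  assert (D1 : forall y x, - a < y < a -> - (1) < x < 1 ->
    is_derive (fun z => S z y) x (sx y x) /\ is_derive (fun z => sx y z) x (sxx y x) /\
    continuity_2d_pt sx y x /\ continuity_2d_pt sxx y x).
  { intros y x H2 H1.
    destruct (Hint x y ltac:(split; simpl; lra)) as [(_ & E1 & _ & (C1 & E2 & _ & (C2 & _) & _) & _) _].
    split; [|split; [now apply Derive_correct|split]].
    - apply is_derive_ext_loc with (fun z => s z y); [|now apply Derive_correct].
      destruct (common_radius (1 - x) (1 + x) 1 1) as (d & B1 & B2 & _ & _); try lra.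
      exists d; intros z Hz; symmetry; apply ES; [|lra].
      apply Rabs_def2 in Hz; change (minus z x) with (z - x) in Hz; lra.
    - now apply (continuity_2d_swap (fun x y => sx y x)).
    - now apply (continuity_2d_swap (fun x y => sxx y x)). }
  assert (C' : forall x y, continuity_2d_pt (fun y x => S x y) x y)
    by (intros; now apply continuity_2d_swap).
  destruct (steklov_strip_intro 1 a sigma S sy syy) as [V HV]; auto; try lra.
  { intros x H1 eps He; destruct (Hy x H1) as [N _].
    destruct (normal_derivative_bound _ _ _ _ _ _ N He) as [d [Hd B]].
    exists d; split; [exact Hd|]; intros u v Hu Hv Bu Bv.
    rewrite ES by lra.
    specialize (B u v (conj Hu Hv) Bu Bv); simpl in B.
    rewrite Rmult_0_l, Rmult_1_l, Rplus_0_l in B; exact B. }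
  { intros x H1 eps He; destruct (Hy x H1) as [_ N].
    destruct (normal_derivative_bound _ _ _ _ _ _ N He) as [d [Hd B]].
    exists d; split; [exact Hd|]; intros u v Hu Hv Bu Bv.
    rewrite ES by lra.
    specialize (B u v (conj Hu Hv) Bu Bv); simpl in B.
    rewrite <- Rabs_Ropp; eapply Rle_lt_trans; [right|exact B]; f_equal; unfold sy; ring. }
  destruct (steklov_strip_intro a 1 sigma (fun y x => S x y) sx sxx) as [U HU]; auto; try lra.
  { intros y H1 eps He; destruct (Hx y H1) as [N _].
    destruct (normal_derivative_bound _ _ _ _ _ _ N He) as [d [Hd B]].
    exists d; split; [exact Hd|]; intros v u Hv Hu Bv Bu.
    rewrite ES by lra.
    specialize (B u v (conj Hu Hv) Bu Bv); simpl in B.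
    rewrite Rmult_0_l, Rmult_1_l, Rplus_0_r in B; exact B. }
  { intros y H1 eps He; destruct (Hx y H1) as [_ N].
    destruct (normal_derivative_bound _ _ _ _ _ _ N He) as [d [Hd B]].
    exists d; split; [exact Hd|]; intros v u Hv Hu Bv Bu.
    rewrite ES by lra.
    specialize (B u v (conj Hu Hv) Bu Bv); simpl in B.
    rewrite <- Rabs_Ropp; eapply Rle_lt_trans; [right|exact B]; f_equal; unfold sx.
    change (- (1)) with (-1); ring. }
  exists S; split; [split; [exact C|]|].
  - exists V, syy, U, sxx; split; [exact HV|split; [exact HU|]].
    intros x y H1 H2.
    destruct (Hint x y ltac:(split; simpl; lra)) as [_ L].
    rewrite Rplus_comm; exact L.
  - intros x y [H1 H2]; apply ES; [exact H1|exact H2].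
Qed.

Lemma steklov_eigenspace_product a sigma (p p' p'' q q' q'' : R -> R) :
  (forall x, is_derive p x (p' x)) -> (forall x, is_derive p' x (p'' x)) ->
  (forall x, continuous p'' x) ->
  (forall y, is_derive q y (q' y)) -> (forall y, is_derive q' y (q'' y)) ->
  (forall y, continuous q'' y) ->
  (forall x y, p'' x * q y + p x * q'' y = 0) ->
  p' 1 = sigma * p 1 -> p' (-1) = - (sigma * p (-1)) ->
  q' a = sigma * q a -> q' (- a) = - (sigma * q (- a)) ->
  steklov_eigenspace a sigma (fun x y => p x * q y).
Proof.
  intros Dp Dp' Cp'' Dq Dq' Cq'' Hlap Rp Rp' Rq Rq'.
  assert (Cp := continuous_of_is_derive p p' Dp).
  assert (Cp' := continuous_of_is_derive p' p'' Dp').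
  assert (Cq := continuous_of_is_derive q q' Dq).
  assert (Cq' := continuous_of_is_derive q' q'' Dq').
  assert (DX : forall f f' g : R -> R, (forall x, is_derive f x (f' x)) ->
    forall x y, is_derive (fun z => f z * g y) x (f' x * g y)).
  { intros f f' g D x y; assert (D1 := D x); evar_last.
    { auto_derive; [eexists; exact D1|reflexivity]. }
    rewrite (Derive_of_is_derive _ _ _ D1); ring. }
  assert (DY : forall f g g' : R -> R, (forall x, is_derive g x (g' x)) ->
    forall x y, is_derive (fun z => f x * g z) y (f x * g' y)).
  { intros f g g' D x y; assert (D1 := D y); evar_last.
    { auto_derive; [eexists; exact D1|reflexivity]. }
    rewrite (Derive_of_is_derive _ _ _ D1); ring. }
  assert (EX : forall x y, Derive (fun z => p z * q y) x = p' x * q y)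
    by (intros; apply Derive_of_is_derive, DX, Dp).
  assert (EY : forall x y, Derive (fun z => p x * q z) y = p x * q' y)
    by (intros; apply Derive_of_is_derive, DY, Dq).
  assert (N : forall P n lim, fst n * (p' (fst P) * q (snd P)) + snd n * (p (fst P) * q' (snd P)) = lim ->
    is_normal_derivative a (fun x y => p x * q y) P n lim).
  { intros [P1 P2] n lim <-; unfold is_normal_derivative.
    apply filterlim_within_ext with
      (fun z : R * R => fst n * (p' (fst z) * q (snd z)) + snd n * (p (fst z) * q' (snd z))).
    - intros [x y] _; simpl; rewrite <- EX, <- EY; reflexivity.
    - eapply filterlim_filter_le_1; [apply filter_le_within|].
      apply (proj1 (continuity_2d_pt_filterlim (fun x y => fst n * (p' x * q y) + snd n * (p x * q' y)) _ _)).
      cont2. }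
  split; [|split; [|split]].
  - intros [x y] _; eapply filterlim_filter_le_1; [apply filter_le_within|].
    apply (proj1 (continuity_2d_pt_filterlim (fun x y => p x * q y) _ _)); cont2.
  - intros x y _; split.
    + split; [cont2|split; [|split; [|split]]].
      * eexists; apply DX, Dp.
      * eexists; apply DY, Dq.
      * apply ex_diff_n_ext_loc with (fun x y => p' x * q y).
        { exists (mkposreal 1 Rlt_0_1); intros; now rewrite EX. }
        split; [cont2|split; [|split; [|split]]].
        -- eexists; apply DX, Dp'.
        -- eexists; apply DY, Dq.
        -- split; [|exact I].
           apply continuity_2d_pt_ext with (fun x y => p'' x * q y); [|cont2].
           intros; symmetry; apply Derive_of_is_derive, DX, Dp'.
        -- split; [|exact I].
           apply continuity_2d_pt_ext with (fun x y => p' x * q' y); [|cont2].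
           intros; symmetry; apply Derive_of_is_derive, DY, Dq.
      * apply ex_diff_n_ext_loc with (fun x y => p x * q' y).
        { exists (mkposreal 1 Rlt_0_1); intros; now rewrite EY. }
        split; [cont2|split; [|split; [|split]]].
        -- eexists; apply DX, Dp.
        -- eexists; apply DY, Dq'.
        -- split; [|exact I].
           apply continuity_2d_pt_ext with (fun x y => p' x * q' y); [|cont2].
           intros; symmetry; apply Derive_of_is_derive, DX, Dp.
        -- split; [|exact I].
           apply continuity_2d_pt_ext with (fun x y => p x * q'' y); [|cont2].
           intros; symmetry; apply Derive_of_is_derive, DY, Dq'.
    + rewrite <- (Hlap x y); unfold laplacian, partial_derive; simpl; f_equal.
      * rewrite (Derive_ext _ (fun z => p' z * q y)) by (intros; apply EX).
        apply Derive_of_is_derive, DX, Dp'.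
      * rewrite (Derive_ext _ (fun z => p x * q' z)) by (intros; apply EY).
        apply Derive_of_is_derive, DY, Dq'.
  - intros y _; split; apply N; simpl; [rewrite Rp|rewrite Rp']; ring.
  - intros x _; split; apply N; simpl; [rewrite Rq|rewrite Rq']; ring.
Qed.

(** * Comparison of the frequencies *)

Lemma sinh_pos x : 0 < x -> 0 < sinh x.
Proof. intros H; unfold sinh; assert (exp (- x) < exp x) by (apply exp_increasing; lra); lra. Qed.

Lemma cosh_ge_1 x : 1 <= cosh x.
Proof.
  assert (H := cosh_pos x). unfold cosh in *.
  assert (P : exp x * exp (- x) = 1) by (rewrite <- exp_plus, Rplus_opp_r; apply exp_0).
  assert (Q := Rle_0_sqr (exp x - exp (- x))); unfold Rsqr in Q. nra.
Qed.

Lemma sinh_ge_id x : 0 <= x -> x <= sinh x.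
Proof.
  intros Hx; destruct (MVT_gen sinh 0 x cosh) as [c [_ E]].
  - intros; apply is_derive_sinh.
  - intros; apply continuity_pt_filterlim, continuous_sinh.
  - rewrite sinh_0 in E; assert (H := cosh_ge_1 c); nra.
Qed.

(** The derivative of [sin x - x * cos x] is [x * sin x]. The inequality serves to bound
    [sigma1 = nu cot nu] below 1. *)
Lemma mul_cos_lt_sin x : 0 < x < PI -> x * cos x < sin x.
Proof.
  intros Hx.
  assert (M : forall u v, 0 <= u -> u < v -> v < PI -> exists c, u <= c <= v /\
    (sin v - v * cos v) - (sin u - u * cos u) = c * sin c * (v - u)).
  { intros u v H1 H2 H3.
    destruct (MVT_gen (fun t => sin t - t * cos t) u v (fun t => t * sin t)) as [c [Hc E]].
    - intros; auto_derive; [exact I|ring].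
    - intros; apply continuity_pt_ex_derive.
      auto_derive; exact I.
    - rewrite Rmin_left, Rmax_right in Hc by lra; exists c; split; [exact Hc|exact E]. }
  (* The intermediate point may be 0, where the derivative vanishes, so strictness comes from the
     second half of the interval. *)
  destruct (M 0 (x / 2)) as [c [Hc E]]; try lra.
  destruct (M (x / 2) x) as [d [Hd E']]; try lra.
  assert (0 <= sin c) by (apply sin_ge_0; lra).
  assert (0 < sin d) by (apply sin_gt_0; lra).
  assert (0 <= c * sin c * (x / 2 - 0)) by (repeat apply Rmult_le_pos; lra).
  assert (0 < d * sin d * (x - x / 2)) by (repeat apply Rmult_lt_0_compat; lra).
  rewrite sin_0 in E; lra.
Qed.

(** Monotonicity of [tan x * coth x], cleared of denominators: the numerator of its derivative is
    [cosh x * sinh x - sin x * cos x], positive because [sin x * cos x < x <= sinh x * cosh x]. *)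
Lemma sin_cosh_ratio_increasing s t : 0 < s -> s < t -> t < PI / 2 ->
  sin s * cosh s * (cos t * sinh t) < sin t * cosh t * (cos s * sinh s).
Proof.
  intros Hs Hst Ht.
  assert (Pc : forall x, s <= x <= t -> 0 < cos x) by (intros; apply cos_gt_0; lra).
  assert (Psh : forall x, s <= x <= t -> 0 < sinh x) by (intros; apply sinh_pos; lra).
  assert (D : forall x, s <= x <= t -> is_derive (fun x => sin x * cosh x / (cos x * sinh x)) x
    ((cosh x * sinh x - sin x * cos x) / (cos x * sinh x) ^ 2)).
  { intros x Hx; specialize (Pc x Hx); specialize (Psh x Hx); evar_last.
    - auto_derive; [|reflexivity].
      apply Rmult_integral_contrapositive_currified; lra.
    - assert (E1 := sin2_cos2 x); unfold Rsqr in E1.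
      assert (E2 : cosh x * cosh x = 1 + sinh x * sinh x).
      { unfold cosh, sinh.
        assert (P : exp x * exp (- x) = 1) by (rewrite <- exp_plus, Rplus_opp_r; apply exp_0).
        nra. }
      apply (Rmult_eq_reg_r ((cos x * sinh x) ^ 2)); [|apply pow_nonzero; nra].
      field_simplify; [|lra|lra].
      replace (sin x ^ 2) with (1 - cos x ^ 2) by (rewrite <- E1; ring).
      replace (cosh x ^ 2) with (1 + sinh x ^ 2) by (rewrite <- Rsqr_pow2; unfold Rsqr; lra).
      ring. }
  destruct (MVT_gen (fun x => sin x * cosh x / (cos x * sinh x)) s t
    (fun x => (cosh x * sinh x - sin x * cos x) / (cos x * sinh x) ^ 2)) as [c [Hc E]].
  - intros x Hx; rewrite Rmin_left, Rmax_right in Hx by lra; apply D; lra.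
  - intros x Hx; rewrite Rmin_left, Rmax_right in Hx by lra.
    apply continuity_pt_ex_derive.
    eexists; apply D; lra.
  - rewrite Rmin_left, Rmax_right in Hc by lra.
    assert (Pos : 0 < cosh c * sinh c - sin c * cos c).
    { assert (A1 := sinh_ge_id c ltac:(lra)); assert (A2 := sin_lt_x c ltac:(lra)).
      assert (A3 := cosh_ge_1 c); assert (A4 := COS_bound c).
      assert (A5 : 0 < cos c) by (apply Pc; lra).
      assert (sin c * cos c < c) by nra. nra. }
    assert (Q : 0 < (cosh c * sinh c - sin c * cos c) / (cos c * sinh c) ^ 2 * (t - s)).
    { apply Rmult_lt_0_compat; [|lra]; apply Rdiv_lt_0_compat; [exact Pos|].
      apply pow_lt, Rmult_lt_0_compat; [apply Pc|apply Psh]; lra. }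
    rewrite <- E in Q.
    assert (P1 : 0 < cos t * sinh t) by (apply Rmult_lt_0_compat; [apply Pc|apply Psh]; lra).
    assert (P2 : 0 < cos s * sinh s) by (apply Rmult_lt_0_compat; [apply Pc|apply Psh]; lra).
    apply (Rmult_lt_reg_r (/ (cos t * sinh t) * / (cos s * sinh s))).
    { apply Rmult_lt_0_compat; now apply Rinv_0_lt_compat. }
    apply Rminus_lt_0; eapply Rlt_le_trans; [exact Q|right; field].
    repeat split; apply Rgt_not_eq; first [apply Pc|apply Psh]; lra.
Qed.


Definition gap (a t : R) : R := cos t * cosh (t * a) - sin t * sinh (t * a).

Lemma continuous_gap a t : continuous (gap a) t.
Proof.
  apply (ex_derive_continuous (V := R_NormedModule)); unfold gap; auto_derive; exact I.
Qed.

(* The frequency equation in the pole-free form [gap a nu = 0]. *)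
Lemma first_frequency a nu :
  0 < a ->
  is_least (fun t => 0 < t /\ cos t <> 0 /\ tan t = coth (t * a)) nu ->
  0 < nu < PI / 2 /\ gap a nu = 0 /\ forall t, 0 < t < nu -> 0 < gap a t.
Proof.
  intros Ha [(Hnu & Hcos & E) Hleast].
  assert (Least : forall t, 0 < t -> gap a t = 0 -> nu <= t).
  { intros t Ht G; apply Hleast.
    assert (Hs : 0 < sinh (t * a)) by (apply sinh_pos, Rmult_lt_0_compat; lra).
    assert (Hc : cos t <> 0).
    { intros Hc; unfold gap in G; rewrite Hc in G.
      assert (Q := sin2_cos2 t); unfold Rsqr in Q; rewrite Hc in Q.
      assert (sin t = 0) by nra. nra. }
    repeat split; auto; unfold tan, coth, gap in *.
    apply (Rmult_eq_reg_r (cos t * sinh (t * a))).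
    - field_simplify; lra.
    - apply Rmult_integral_contrapositive_currified; lra. }
  (* Since [gap a 0 = 1], a nonpositive value forces an earlier root. Used at [PI / 2], where only
     the negative term survives, this gives [nu < PI / 2]. *)
  assert (Root : forall t, 0 < t -> gap a t <= 0 -> exists z, 0 < z <= t /\ gap a z = 0).
  { intros t Ht G.
    destruct (IVT_cor (gap a) 0 t) as [z [Hz Gz]]; [| lra | |].
    - intros x; apply continuity_pt_filterlim, continuous_gap.
    - unfold gap at 1; rewrite Rmult_0_l, cos_0, sin_0, cosh_0; lra.
    - exists z; split; [|exact Gz].
      destruct (Req_dec z 0) as [->|]; [|lra].
      unfold gap in Gz; rewrite Rmult_0_l, cos_0, sin_0, cosh_0 in Gz; lra. }
  assert (P2 := PI2_RGT_0).
  split; [split; [exact Hnu|]|split].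
  - assert (G : gap a (PI / 2) < 0).
    { unfold gap; rewrite cos_PI2, sin_PI2.
      assert (0 < sinh (PI / 2 * a)) by (apply sinh_pos, Rmult_lt_0_compat; lra). lra. }
    destruct (Root (PI / 2)) as [z [Hz Gz]]; try lra.
    apply Rle_lt_trans with z; [apply Least; [lra|auto]|].
    destruct (Req_dec z (PI / 2)) as [->|]; lra.
  - assert (0 < sinh (nu * a)) by (apply sinh_pos, Rmult_lt_0_compat; lra).
    unfold gap; unfold tan, coth in E.
    replace (sin nu) with (sin nu / cos nu * cos nu) by (field; auto).
    rewrite E; field; lra.
  - intros t Ht; apply Rnot_le_lt; intros G.
    destruct (Root t) as [z [Hz Gz]]; try lra.
    assert (nu <= z) by (apply Least; [lra|auto]). lra.
Qed.

Lemma robin_root_exists l sigma t : 0 < t -> 0 < sigma ->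
  sigma * cosh (t * l) <= t * sinh (t * l) -> exists r, robin_root l sigma r /\ r <= t.
Proof.
  intros Ht Hs H.
  destruct (IVT_cor (fun r => r * sinh (r * l) - sigma * cosh (r * l)) 0 t) as [z [Hz E]].
  - intros x; apply continuity_pt_ex_derive.
    auto_derive; exact I.
  - lra.
  - rewrite !Rmult_0_l, cosh_0; nra.
  - exists z; repeat split; try lra.
    destruct (Req_dec z 0) as [->|]; [|lra].
    rewrite !Rmult_0_l, cosh_0 in E; lra.
Qed.

(* With [p < nu], the curve [sin s sinh t = cos s cosh t] is never met at [(p a, p)]. *)
Lemma cross_mode_nonresonant a nu p :
  0 < a < 1 -> nu < PI / 2 -> (forall t, 0 < t < nu -> 0 < gap a t) -> 0 < p < nu ->
  0 < cos (p * a) * cosh p - sin (p * a) * sinh p.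
Proof.
  intros Ha Hnu Hgap Hp.
  assert (G := Hgap p Hp); unfold gap in G.
  assert (Hpa : 0 < p * a < p) by nra.
  (* With [G] this reads [tan (p a) tanh p < tan p tanh (p a) < 1]. *)
  assert (Q := sin_cosh_ratio_increasing (p * a) p ltac:(lra) ltac:(lra) ltac:(lra)).
  assert (C1 : 0 < cos p) by (apply cos_gt_0; lra).
  assert (C2 : 0 < cos (p * a)) by (apply cos_gt_0; lra).
  assert (K1 := cosh_pos p); assert (K2 := cosh_pos (p * a)).
  apply Rnot_le_lt; intros N.
  assert (A1 : 0 < cos p * cosh (p * a)) by now apply Rmult_lt_0_compat.
  assert (A2 : 0 < cos (p * a) * cosh p) by now apply Rmult_lt_0_compat.
  nra.
Qed.

(** This factor multiplies the cosine amplitude of a mode, which must therefore be zero. *)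
Lemma cosine_factor_pos l sigma r :
  0 < l <= 1 -> 0 < sigma -> 0 < r < PI / 2 -> 0 < r * sin (r * l) + sigma * cos (r * l).
Proof.
  intros Hl Hs Hr.
  assert (Hrl : 0 < r * l <= r) by nra.
  assert (0 < sin (r * l)) by (apply sin_gt_0; assert (P := PI_RGT_0); lra).
  assert (0 < cos (r * l)) by (apply cos_gt_0; lra).
  apply Rplus_lt_0_compat; now apply Rmult_lt_0_compat.
Qed.

(** The mode along [cosh (p * x)], with [p tanh p = sigma], is trigonometric in [y]. Eliminating
    [sigma] from its Robin condition gives [cos (p a) cosh p = sin (p a) sinh p], impossible for
    [p < nu]. The bound on [sigma] is weak so that [sigma1] itself is covered. *)
Lemma cross_mode_zero a nu sigma (S : R -> R -> R) :
  0 < a < 1 -> 0 < nu < PI / 2 -> gap a nu = 0 -> (forall t, 0 < t < nu -> 0 < gap a t) ->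
  0 < sigma < 1 -> sigma * cosh (nu * a) <= nu * sinh (nu * a) -> green_null 1 a sigma S ->
  exists p, robin_root 1 sigma p /\ forall y, - a <= y <= a ->
    RInt (fun x => S x y * cosh (p * x)) (- (1)) 1 = 0.
Proof.
  intros Ha Hnu G0 Hgap Hs Hsn HS.
  assert (K1 := cosh_pos (nu * a)); assert (K2 := cosh_pos nu).
  (* Here [a < 1] enters: [tanh (nu a) < tanh nu], so even at [sigma1] the root [p] lies strictly
     below [nu]. *)
  assert (D : 0 < sinh nu * cosh (nu * a) - cosh nu * sinh (nu * a)).
  { replace (_ - _) with (sinh (nu * (1 - a))); [apply sinh_pos, Rmult_lt_0_compat; lra|].
    replace (nu * (1 - a)) with (nu + - (nu * a)) by ring.
    unfold sinh, cosh; rewrite !Ropp_plus_distr, !Ropp_involutive, !exp_plus; field. }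
  assert (Hlt : sigma * cosh nu < nu * sinh nu).
  { apply (Rmult_lt_reg_r (cosh (nu * a))); [exact K1|].
    apply Rle_lt_trans with (nu * sinh (nu * a) * cosh nu); nra. }
  destruct (robin_root_exists 1 sigma nu) as [p [Hp Hpn]]; try lra.
  { rewrite !Rmult_1_r; lra. }
  assert (Hp0 := proj1 Hp).
  assert (Hpn' : p < nu).
  { destruct (Req_dec p nu) as [->|]; [|lra].
    destruct Hp as [_ E]; rewrite Rmult_1_r in E; lra. }
  exists p; split; [exact Hp|].
  destruct (green_null_mode_trig a 1 sigma p (fun y x => S x y)) as (A & B & HA & HB & E);
    try lra; try nra.
  { now apply green_null_swap. }
  { exact Hp. }
  assert (A0 : A = 0).
  { assert (P := cosine_factor_pos a sigma p ltac:(lra) ltac:(lra) ltac:(lra)).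
    destruct (Rmult_integral _ _ HA); lra. }
  assert (B0 : B = 0).
  { assert (P := cross_mode_nonresonant a nu p Ha (proj2 Hnu) Hgap ltac:(lra)).
    destruct (Rmult_integral _ _ HB) as [|Z]; [assumption|exfalso].
    destruct Hp as [_ Ep]; rewrite Rmult_1_r in Ep.
    assert (K := cosh_pos p).
    assert (p * (cos (p * a) * cosh p - sin (p * a) * sinh p) = 0).
    { transitivity ((p * cos (p * a) - sigma * sin (p * a)) * cosh p
        + sin (p * a) * (sigma * cosh p - p * sinh p)); [ring|].
      rewrite Z, Ep; ring. }
    nra. }
  intros y Hy; rewrite (E y Hy), A0, B0; eqR; ring.
Qed.

(** Eliminating [sigma] between the Robin condition of the sine and the equation of the root [r]
    leaves [gap a r] as the factor of [B]. Hence [B = 0] for [r < nu], while [B] is free at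
    [r = nu]. *)
Lemma main_mode_sine a sigma r (S : R -> R -> R) :
  0 < a < 1 -> 0 < r < PI / 2 -> 0 < sigma < 1 -> green_null 1 a sigma S ->
  robin_root a sigma r ->
  exists B, B * gap a r = 0 /\ forall x, - (1) <= x <= 1 ->
    RInt (fun y => S x y * cosh (r * y)) (- a) a = B * sin (r * x).
Proof.
  intros Ha Hr Hs HS Hroot.
  destruct (green_null_mode_trig 1 a sigma r S) as (A & B & HA & HB & E); try lra; try nra; auto.
  assert (A0 : A = 0).
  { assert (P := cosine_factor_pos 1 sigma r ltac:(lra) ltac:(lra) Hr).
    destruct (Rmult_integral _ _ HA); lra. }
  exists B; split.
  - rewrite !Rmult_1_r in HB; destruct Hroot as [_ Er].
    apply (Rmult_eq_reg_l r); [|lra].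
    transitivity (B * (r * cos r - sigma * sin r) * cosh (r * a)
      + B * sin r * (sigma * cosh (r * a) - r * sinh (r * a))); [unfold gap; ring|].
    rewrite HB, Er; ring.
  - intros x Hx; rewrite (E x Hx), A0; eqR; ring.
Qed.

(** * The spectrum up to the first eigenvalue *)

Lemma steklov_data_below_zero a nu sigma1 sigma (S : R -> R -> R) :
  0 < a < 1 -> 0 < nu < PI / 2 -> gap a nu = 0 -> (forall t, 0 < t < nu -> 0 < gap a t) ->
  nu * sinh (nu * a) = sigma1 * cosh (nu * a) -> sigma1 < 1 ->
  sigma <> 0 -> sigma < sigma1 -> steklov_data 1 a sigma S ->
  forall x y, - (1) <= x <= 1 -> - a <= y <= a -> S x y = 0.
Proof.
  intros Ha Hnu G0 Hgap E1 H1 Hs Hlt HS.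
  assert (Hsa : sigma * a < 1) by (destruct (Rlt_dec sigma 0); nra).
  assert (HN : green_null 1 a sigma S).
  { split; [apply HS|]; apply green_sum_zero; auto; lra. }
  apply (green_null_zero 1 a sigma S); auto; try lra.
  destruct (Rlt_dec sigma 0) as [|Hpos]; [now left|right].
  assert (K := cosh_pos (nu * a)).
  assert (Hle : sigma * cosh (nu * a) < nu * sinh (nu * a)) by (rewrite E1; nra).
  split.
  - apply (cross_mode_zero a nu sigma S); auto; lra.
  - destruct (robin_root_exists a sigma nu) as [r [Hr Hrn]]; try lra.
    assert (Hr0 := proj1 Hr).
    assert (Hrn' : r < nu).
    { destruct (Req_dec r nu) as [->|]; [|lra]; destruct Hr; lra. }
    destruct (main_mode_sine a sigma r S) as [B [HB E]]; try lra; auto.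
    exists r; split; [exact Hr|]; intros x Hx; rewrite (E x Hx).
    assert (P := Hgap r ltac:(lra)).
    destruct (Rmult_integral _ _ HB) as [->|]; [eqR; ring|lra].
Qed.

(** The second hypothesis is the Robin condition in [y]; the frequency equation turns it into
    [nu * cos nu = sigma1 * sin nu], the condition in [x]. *)
Lemma first_eigenfunction a nu sigma1 :
  gap a nu = 0 -> nu * sinh (nu * a) = sigma1 * cosh (nu * a) ->
  steklov_eigenspace a sigma1 (fun x y => sin (nu * x) * cosh (nu * y)).
Proof.
  intros G E.
  assert (K := cosh_pos (nu * a)).
  assert (Ecos : nu * cos nu = sigma1 * sin nu).
  { apply (Rmult_eq_reg_r (cosh (nu * a))); [|lra].
    unfold gap in G.
    transitivity (nu * (cos nu * cosh (nu * a) - sin nu * sinh (nu * a))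
      + sin nu * (nu * sinh (nu * a))); [ring|].
    rewrite G, E; ring. }
  apply (steklov_eigenspace_product a sigma1 (fun x => sin (nu * x))
    (fun x => nu * cos (nu * x)) (fun x => - (nu * nu * sin (nu * x)))
    (fun y => cosh (nu * y)) (fun y => nu * sinh (nu * y)) (fun y => nu * nu * cosh (nu * y))).
  - intros; auto_derive; [exact I|ring].
  - intros; auto_derive; [exact I|ring].
  - intros; apply (ex_derive_continuous (V := R_NormedModule)); auto_derive; exact I.
  - intros; auto_derive; [exact I|ring].
  - intros; auto_derive; [exact I|ring].
  - intros; apply (ex_derive_continuous (V := R_NormedModule)); auto_derive; exact I.
  - intros; ring.
  - rewrite Rmult_1_r; exact Ecos.
  - replace (nu * -1) with (- nu) by ring; rewrite cos_neg, sin_neg; lra.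
  - exact E.
  - replace (nu * - a) with (- (nu * a)) by ring; rewrite cosh_opp, sinh_opp; lra.
Qed.

(** Subtracting the right multiple of [F] removes the only mode that can survive at [sigma1]; the
    remainder is orthogonal to both negative modes and vanishes. *)
Lemma first_eigenspace_line a nu sigma1 (S F : R -> R -> R) :
  0 < a < 1 -> 0 < nu < PI / 2 -> gap a nu = 0 -> (forall t, 0 < t < nu -> 0 < gap a t) ->
  nu * sinh (nu * a) = sigma1 * cosh (nu * a) -> 0 < sigma1 < 1 ->
  steklov_data 1 a sigma1 S -> steklov_data 1 a sigma1 F ->
  (forall x y, - (1) <= x <= 1 -> - a <= y <= a -> F x y = sin (nu * x) * cosh (nu * y)) ->
  exists k, forall x y, - (1) <= x <= 1 -> - a <= y <= a ->
    S x y = k * (sin (nu * x) * cosh (nu * y)).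
Proof.
  intros Ha Hnu G0 Hgap E1 Hs HS HF EF.
  assert (NS : green_null 1 a sigma1 S).
  { split; [apply HS|]; apply green_sum_zero; auto; nra. }
  assert (NF : green_null 1 a sigma1 F).
  { split; [apply HF|]; apply green_sum_zero; auto; nra. }
  assert (Hroot : robin_root a sigma1 nu) by (split; [lra|exact E1]).
  destruct (main_mode_sine a sigma1 nu S) as [B [_ EB]]; auto.
  pose (N := RInt (fun y => cosh (nu * y) * cosh (nu * y)) (- a) a).
  assert (Cc := continuous_cosh_scal nu).
  assert (HN : 0 < N).
  { apply RInt_gt_0; [lra| |intros; cont].
    intros; apply Rmult_lt_0_compat; apply cosh_pos. }
  (* [F] has component [N * sin (nu * x)] along [cosh (nu * y)] and [S] has [B * sin (nu * x)], so
     this [k] cancels them. *)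
  pose (k := B / N).
  pose (e := fun x y => S x y + (- k) * F x y).
  assert (CS := proj1 NS); assert (CF := proj1 NF).
  assert (Ne : green_null 1 a sigma1 e).
  { split; [unfold e; cont2|]; intros x y Hx Hy; unfold green_sum, e.
    rewrite (green_lin 1 sigma1 (fun x => S x y) (fun x => F x y))
      by (intros; now apply continuous_slice_1).
    rewrite (green_lin a sigma1 (fun y => S x y) (fun y => F x y))
      by (intros; now apply continuous_slice_2).
    assert (Q1 := proj2 NS x y Hx Hy); assert (Q2 := proj2 NF x y Hx Hy).
    unfold green_sum in Q1, Q2.
    change (fun y => S x y) with (S x); change (fun y => F x y) with (F x).
    transitivity ((green 1 sigma1 (fun x => S x y) x + green a sigma1 (S x) y)
      + - k * (green 1 sigma1 (fun x => F x y) x + green a sigma1 (F x) y)); [ring|].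
    rewrite Q1, Q2; ring. }
  assert (Z : forall x y, - (1) <= x <= 1 -> - a <= y <= a -> e x y = 0).
  { apply (green_null_zero 1 a sigma1 e); auto; try lra; try nra.
    right; split.
    - apply (cross_mode_zero a nu sigma1 e); auto; lra.
    - exists nu; split; [exact Hroot|]; intros x Hx.
      rewrite (RInt_ext_le _ (fun y => S x y * cosh (nu * y)
        - (k * sin (nu * x)) * (cosh (nu * y) * cosh (nu * y)))); [|lra|].
      + rewrite RInt_Rminus, RInt_Rscal, (EB x Hx).
        * fold N; unfold k; eqR; field; lra.
        * cont.
        * intros; apply continuous_Rmult; [now apply (continuous_slice_2 S)|apply Cc].
        * cont.
      + intros t Ht; unfold e; rewrite EF by lra; ring. }
  exists k; intros x y Hx Hy.
  rewrite <- EF by auto; assert (Q := Z x y Hx Hy); unfold e in Q; lra.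
Qed.

(* [cos t <> 0] is the domain of definition of [tan]. *)
Theorem theorem1p2 :
  forall (a nu : R),
    0 < a < 1 ->
    is_least (fun t => 0 < t /\ cos t <> 0 /\ tan t = coth (t * a)) nu ->
    exists sigma1 : R,
      is_first_steklov_eigenvalue a sigma1 /\
      is_basis a (steklov_eigenspace a sigma1)
        [fun x y => sin (nu * x) * cosh (nu * y)].
Proof.
  intros a nu Ha Hleast.
  destruct (first_frequency a nu (proj1 Ha) Hleast) as (Hnu & G0 & Hgap).
  assert (K := cosh_pos (nu * a)).
  assert (Hsh : 0 < sinh (nu * a)) by (apply sinh_pos, Rmult_lt_0_compat; lra).
  (* The value [nu tanh (nu a)] is forced by the Robin condition of [cosh (nu * y)] at [y = a]. *)
  pose (sigma1 := nu * sinh (nu * a) / cosh (nu * a)).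
  assert (E1 : nu * sinh (nu * a) = sigma1 * cosh (nu * a)) by (unfold sigma1; field; lra).
  assert (Hsin : 0 < sin nu) by (apply sin_gt_0; assert (P := PI_RGT_0); lra).
  assert (Hs0 : 0 < sigma1).
  { unfold sigma1; apply Rdiv_lt_0_compat; [apply Rmult_lt_0_compat|]; lra. }
  assert (Hs1 : sigma1 < 1).
  (* By the frequency equation [sigma1 * sin nu = nu * cos nu], which is less than [sin nu]. *)
  { assert (Q := mul_cos_lt_sin nu ltac:(assert (P := PI_RGT_0); lra)).
    apply (Rmult_lt_reg_r (sin nu * cosh (nu * a))); [now apply Rmult_lt_0_compat|].
    unfold gap in G0; nra. }
  assert (Hphi := first_eigenfunction a nu sigma1 G0 E1).
  assert (Hone : rect a (1, 0)) by (split; simpl; lra).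
  assert (Hval : sin (nu * 1) * cosh (nu * 0) = sin nu)
    by (rewrite Rmult_1_r, Rmult_0_r, cosh_0; ring).
  exists sigma1; split; [split|split; [|split]].
  - split; [lra|]. eexists; split; [exact Hphi|].
    exists 1, 0; split; [exact Hone|]; rewrite Hval; lra.
  - intros t [Ht (s & Hs & x & y & Hxy & Hne)].
    apply Rnot_lt_le; intros Hlt; apply Hne.
    destruct (steklov_eigenspace_data a t s (proj1 Ha) Hs) as [S [HS ES]].
    rewrite <- ES by exact Hxy.
    destruct Hxy as [Hx Hy].
    now apply (steklov_data_below_zero a nu sigma1 t S).
  - constructor; [exact Hphi|constructor].
  - intros c Hlen Hc; destruct c as [|k [|]]; try discriminate.
    constructor; [|constructor].
    assert (Q := Hc 1 0 Hone); simpl in Q; rewrite Hval in Q.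
    apply (Rmult_eq_reg_r (sin nu)); lra.
  - intros s Hs.
    destruct (steklov_eigenspace_data a sigma1 s (proj1 Ha) Hs) as [S [HS ES]].
    destruct (steklov_eigenspace_data a sigma1 _ (proj1 Ha) Hphi) as [F [HF EF]].
    destruct (first_eigenspace_line a nu sigma1 S F) as [k Hk]; auto.
    { intros x y Hx Hy; apply EF; split; [exact Hx|exact Hy]. }
    exists [k]; split; [reflexivity|]; intros x y Hxy.
    rewrite <- ES by exact Hxy; destruct Hxy as [Hx Hy].
    rewrite (Hk x y Hx Hy); simpl; ring.
Qed.
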